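(* Let $n\ge 1$. Let $L'$ be the Laurent polynomial ring over $\mathbb{C}$ in the variables $x_U$ ($\emptyset\ne U\subseteq[n]$) and $x_{\langle U;i,j\rangle}$ ($U\subseteq[n]$, $i<j$ in $[n]\setminus U$), with the convention $x_\emptyset=1$, and let $L\subseteq L'$ be the Laurent polynomial subring generated by the variables $x_U^{\pm1}$ only. Let $V'$ be the set of all nowhere-zero vectors of principal and odd almost-principal minors of matrices in $M_n(\mathbb{C})$, and let $V$ be the set of all nowhere-zero vectors of principal minors of matrices in $M_n(\mathbb{C})$. Let $J(V')\subseteq L'$ be the ideal of Laurent polynomials in $L'$ vanishing on $V'$, and let $J(V)\subseteq L$ be the ideal of Laurent polynomials in $L$ vanishing on $V$. Then $J(V')$ is a prime ideal, it is generated by the hexahedron relations on all rank-3 Boolean intervals $[S,S\cup D]$ ($S\subseteq [n]$, $D\subseteq[n]\setminus S$, $|D|=3$), and $J(V)=J(V')\cap L$.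
   Context: $[n]=\{1,\dots,n\}$, and $M_n(\mathbb{C})$ is the set of complex $n\times n$ matrices. For a matrix $M$ and $A,B\subseteq[n]$ with $|A|=|B|$, $M_A^B$ is the submatrix with rows $A$ and columns $B$ (indices in increasing order), with $\det M_\emptyset^\emptyset=1$. A principal minor is $\det M_A^A$. An almost-principal minor is $\det M_{U\cup\{i\}}^{U\cup\{j\}}$ with $i\ne j$ both not in $U$; it is odd if $(i-j)(-1)^{|U|}>0$ and even otherwise. For each $U$ and each pair $i<j$ in $[n]\setminus U$ exactly one of $\det M_{U\cup\{i\}}^{U\cup\{j\}}$, $\det M_{U\cup\{j\}}^{U\cup\{i\}}$ is odd. The symbol $\langle U;i,j\rangle$ denotes the 2-dimensional face $\{U,U\cup\{i\},U\cup\{j\},U\cup\{i,j\}\}$ of the Boolean lattice. The variable $x_U$ stands for $\det M_U^U$ and $x_{\langle U;i,j\rangle}$ stands for the odd one among the two minors above. Hexahedron relation: fourteen quantities $a_0,\dots,a_9,a_0^*,a_1^*,a_2^*,a_3^*$ satisfy the hexahedron relation if $$a_1^*a_1a_0=a_1a_2a_3+a_7a_8a_9+a_0a_4a_7,$$ $$a_2^*a_2a_0=a_1a_2a_3+a_7a_8a_9+a_0a_5a_8,$$ $$a_3^*a_3a_0=a_1a_2a_3+a_7a_8a_9+a_0a_6a_9,$$ $$a_0^*a_0^2a_1a_2a_3=(a_1a_2a_3)^2+a_1a_2a_3(2a_7a_8a_9+a_0a_4a_7+a_0a_5a_8+a_0a_6a_9)+(a_8a_9+a_0a_4)(a_9a_7+a_0a_5)(a_7a_8+a_0a_6).$$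 The hexahedron relations on the rank-3 Boolean interval $[S,S\cup D]$, $D=\{p<q<r\}\subseteq[n]\setminus S$, are the four polynomials (left side minus right side) obtained by substituting (writing $Sq$ for $S\cup\{q\}$, etc.) $$a_8=x_S,\quad a_4=x_{Sp},\quad a_0=x_{Sq},\quad a_6=x_{Sr},$$ $$a_9=-x_{Spq},\quad a_0^*=-x_{Spr},\quad a_7=-x_{Sqr},\quad a_5=-x_{Spqr},$$ $$a_1=x_{\langle S;p,q\rangle},\quad a_3=x_{\langle S;q,r\rangle},\quad a_2^*=x_{\langle S;p,r\rangle},$$ $$a_2=-x_{\langle Sq;p,r\rangle},\quad a_1^*=-x_{\langle Sr;p,q\rangle},\quad a_3^*=-x_{\langle Sp;q,r\rangle}.$$ *)

(* Defs.v *)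
From HB Require Import structures.
From mathcomp Require Import all_boot all_order all_algebra.
From mathcomp Require Import finmap.
From mathcomp Require Export boolp classical_sets reals.
From mathcomp.multinomials Require Import monalg.
From mathcomp.real_closed Require Export complex.

Set Implicit Arguments.
Unset Strict Implicit.
Unset Printing Implicit Defensive.

Import GRing.Theory.

Local Open Scope fset_scope.
Local Open Scope ring_scope.

(* Laurent polynomials over K in the variables indexed by I: finite K-linear
   combinations of monomials with exponents in Z^I.  The carrier is that of the
   monoid algebras of multinomials, but the product has to be redone here
   since monomType excludes nontrivial invertible elements. *)
Section Laurent.
Variable I : finType.

Definition laurent (K : comNzRingType) : Type := {malg K[{ffun I -> int}]}.

Section Ring.
Variable K : comNzRingType.
Local Notation L := (laurent K).
Implicit Types (f g h : L) (k : {ffun I -> int}) (d : {fset {ffun I -> int}}).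

HB.instance Definition _ := GRing.Lmodule.on L.

Definition laurent_one : L := << 0%R >>.

Definition laurent_mul f g : L :=
  \sum_(k1 <- msupp f) \sum_(k2 <- msupp g) << f@_k1 * g@_k2 *g (k1 + k2)%R >>.

Lemma laurent_mulw d1 d2 f g : msupp f `<=` d1 -> msupp g `<=` d2 ->
  laurent_mul f g =
  \sum_(k1 <- d1) \sum_(k2 <- d2) << f@_k1 * g@_k2 *g (k1 + k2)%R >>.
Proof.
move=> le_d1 le_d2; rewrite /laurent_mul (big_fset_incl _ le_d1) /=.
  apply/eq_bigr=> k1 _; apply/big_fset_incl => // k _ /mcoeff_outdom ->.
  by rewrite mulr0 monalgU0.
move=> k _ /mcoeff_outdom fk.
by rewrite big1 => // k' _; rewrite fk mul0r monalgU0.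
Qed.

Lemma laurent_mulC : commutative laurent_mul.
Proof.
move=> f g; rewrite /laurent_mul exchange_big /=.
by do 2![apply/eq_bigr=> ? _]; rewrite mulrC addrC.
Qed.

Lemma laurent_mulDl : left_distributive laurent_mul +%R.
Proof.
move=> f g h; rewrite (laurent_mulw (msuppD_le f g) (fsubset_refl _)).
rewrite (laurent_mulw (fsubsetUl (msupp f) (msupp g)) (fsubset_refl (msupp h))).
rewrite (laurent_mulw (fsubsetUr (msupp f) (msupp g)) (fsubset_refl (msupp h))).
rewrite -big_split /=; apply/eq_bigr=> k1 _.
rewrite -big_split /=; apply/eq_bigr=> k2 _.
by rewrite mcoeffD mulrDl monalgUD.
Qed.

Lemma laurent_mulUU c1 c2 k1 k2 :
  laurent_mul << c1 *g k1 >> << c2 *g k2 >> = << c1 * c2 *g (k1 + k2)%R >>.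
Proof. by rewrite (laurent_mulw msuppU_le msuppU_le) !big_seq_fset1 !mcoeffUU. Qed.

Lemma laurent_mul0f : left_zero 0 laurent_mul.
Proof. by move=> f; rewrite /laurent_mul msupp0 big_seq_fset0. Qed.

Lemma laurent_mul_suml (T : Type) (s : seq T) (F : T -> L) g :
  laurent_mul (\sum_(t <- s) F t) g = \sum_(t <- s) laurent_mul (F t) g.
Proof.
exact: (big_morph (laurent_mul^~ g) (fun _ _ => laurent_mulDl _ _ _) (laurent_mul0f g)).
Qed.

Lemma laurent_mul_sumr (T : Type) (s : seq T) (F : T -> L) g :
  laurent_mul g (\sum_(t <- s) F t) = \sum_(t <- s) laurent_mul g (F t).
Proof.
by rewrite laurent_mulC laurent_mul_suml; apply/eq_bigr=> t _; rewrite laurent_mulC.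
Qed.

Lemma laurent_mulA : associative laurent_mul.
Proof.
move=> f g h; rewrite [f]monalgE (laurent_mul_suml _ _ (laurent_mul g h)).
rewrite (laurent_mul_suml _ _ g) (laurent_mul_suml _ _ h).
apply/eq_bigr=> k1 _; move uE: << _ *g k1 >> => u.
rewrite [g]monalgE (laurent_mul_suml _ _ h) !(laurent_mul_sumr _ _ u).
rewrite (laurent_mul_suml _ _ h); apply/eq_bigr=> k2 _.
move vE: << _ *g k2 >> => v.
rewrite [h]monalgE (laurent_mul_sumr _ _ v) (laurent_mul_sumr _ _ u).
rewrite (laurent_mul_sumr _ _ (laurent_mul u v)).
by apply/eq_bigr=> k3 _; rewrite -uE -vE !laurent_mulUU mulrA addrA.
Qed.

Lemma laurent_mul1f : left_id laurent_one laurent_mul.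
Proof.
move=> f; rewrite {1}[f]monalgE laurent_mul_sumr [RHS]monalgE.
by apply/eq_bigr=> k _; rewrite laurent_mulUU mul1r add0r.
Qed.

Lemma laurent_one_neq0 : laurent_one != 0.
Proof. by rewrite monalgU_eq0 oner_eq0. Qed.

HB.instance Definition _ := GRing.Zmodule_isComNzRing.Build L
  laurent_mulA laurent_mulC laurent_mul1f laurent_mulDl laurent_one_neq0.

Lemma laurent_scaleAl (c : K) f g : c *: (f * g) = (c *: f) * g.
Proof.
have CE h : c *: h = laurent_mul << c *g 0%R >> h.
  rewrite [h in RHS]monalgE laurent_mul_sumr; apply/eq_bigr=> k _.
  by rewrite laurent_mulUU add0r.
by rewrite !CE; exact: laurent_mulA.
Qed.

HB.instance Definition _ := GRing.Lmodule_isLalgebra.Build K L laurent_scaleAl.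
HB.instance Definition _ := GRing.Lalgebra_isComAlgebra.Build K L.

Definition laurent_var (i : I) : L := << [ffun j => (i == j)%:Z] >>.

End Ring.

Definition laurent_eval (K : fieldType) (v : I -> K) (f : laurent K) : K :=
  mmap idfun (fun k : {ffun I -> int} => \prod_i v i ^ k i) f.

End Laurent.

Local Open Scope classical_set_scope.

(* The homomorphism of K-algebras mapping the variable of index i to the
   variable of index h i. *)
Definition laurent_rename (I I' : finType) (K : comNzRingType) (h : I -> I')
    (f : laurent I K) : laurent I' K :=
  \sum_(k <- msupp f)
    << f@_k *g [ffun i' => \sum_(i | h i == i') (k : {ffun I -> int}) i] >>.

Definition vanishing_ideal (I : finType) (K : fieldType) (V : set (I -> K)) :
    set (laurent I K) :=
  [set f | forall v, V v -> laurent_eval v f = 0].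

Definition ideal_gen (A : comNzRingType) (G : set A) : set A :=
  [set f | exists s : seq (A * A),
     (forall t, t \in s -> G t.2) /\ f = \sum_(t <- s) t.1 * t.2].

Definition prime_ideal (A : comNzRingType) (J : set A) : Prop :=
  idealr_closed [in J] /\ prime_idealr_closed [in J].

(* The definition is meant for #|A| = #|B|; then the default value of nth is
   never used.  Enumerations of subsets of 'I_n are increasing. *)
Definition minor (K : comNzRingType) (n : nat) (M : 'M[K]_n)
    (A B : {set 'I_n}) : K :=
  \det (\matrix_(k < #|A|, l < #|A|)
          M (enum_val k) (nth (enum_val k) (enum B) l)).

Definition principal_minor (K : comNzRingType) (n : nat) (M : 'M[K]_n)
    (U : {set 'I_n}) : K :=
  minor M U U.

Definition almost_principal_minor (K : comNzRingType) (n : nat) (M : 'M[K]_n)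
    (U : {set 'I_n}) (i j : 'I_n) : K :=
  minor M (i |: U)%SET (j |: U)%SET.

Definition is_odd (n : nat) (U : {set 'I_n}) (i j : 'I_n) : bool :=
  (0 < ((i : nat)%:Z - (j : nat)%:Z) * (-1) ^+ #|U| :> int)%R.

Definition odd_minor (K : comNzRingType) (n : nat) (M : 'M[K]_n)
    (U : {set 'I_n}) (i j : 'I_n) : K :=
  if is_odd U i j then almost_principal_minor M U i j
  else almost_principal_minor M U j i.

Definition is_face (n : nat) (t : {set 'I_n} * ('I_n * 'I_n)) : bool :=
  [&& (t.2.1 < t.2.2)%N, t.2.1 \notin t.1 & t.2.2 \notin t.1].

(* Indices of the variables x_U, and of all the variables. *)
Definition pindex (n : nat) : finType := {U : {set 'I_n} | U != finset.set0}.

Definition face (n : nat) : finType :=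
  {t : {set 'I_n} * ('I_n * 'I_n) | is_face t}.

Definition var_index (n : nat) : finType := (pindex n + face n)%type.

Definition principal_vector (K : comNzRingType) (n : nat) (M : 'M[K]_n) :
    pindex n -> K :=
  fun U => principal_minor M (val U).

Definition minor_vector (K : comNzRingType) (n : nat) (M : 'M[K]_n) :
    var_index n -> K :=
  fun z => match z with
           | inl U => principal_minor M (val U)
           | inr t => odd_minor M (val t).1 (val t).2.1 (val t).2.2
           end.

Definition nowhere_zero (I : Type) (K : nzRingType) (v : I -> K) : Prop :=
  forall z, v z != 0.

Definition V' (K : fieldType) (n : nat) : set (var_index n -> K) :=
  [set v | nowhere_zero v /\ exists M : 'M[K]_n, v = minor_vector M].

Definition V (K : fieldType) (n : nat) : set (pindex n -> K) :=
  [set v | nowhere_zero v /\ exists M : 'M[K]_n, v = principal_vector M].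

Definition L' (K : fieldType) (n : nat) : comNzRingType := laurent (var_index n) K.

Definition L (K : fieldType) (n : nat) : comNzRingType := laurent (pindex n) K.

Definition L_incl (K : fieldType) (n : nat) : L K n -> L' K n :=
  laurent_rename inl.

Section Variables.
Variables (K : fieldType) (n : nat).

(* insub U is None exactly when U is empty, whence the convention x_0 = 1. *)
Definition x_set (U : {set 'I_n}) : L' K n :=
  if (insub U : option (pindex n)) is Some u
  then laurent_var K (inl u : var_index n) else 1.

(* The value 0 is a dummy, for arguments that do not define a face. *)
Definition x_face (U : {set 'I_n}) (i j : 'I_n) : L' K n :=
  if (insub (U, (i, j)) : option (face n)) is Some t
  then laurent_var K (inr t : var_index n) else 0.

End Variables.

(* b0, b1, b2, b3 are the starred quantities. *)
Definition hexahedron (A : comNzRingType)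
    (a0 a1 a2 a3 a4 a5 a6 a7 a8 a9 b0 b1 b2 b3 : A) : seq A :=
  [:: b1 * a1 * a0 - (a1 * a2 * a3 + a7 * a8 * a9 + a0 * a4 * a7);
      b2 * a2 * a0 - (a1 * a2 * a3 + a7 * a8 * a9 + a0 * a5 * a8);
      b3 * a3 * a0 - (a1 * a2 * a3 + a7 * a8 * a9 + a0 * a6 * a9);
      b0 * a0 ^+ 2 * a1 * a2 * a3
      - ((a1 * a2 * a3) ^+ 2
         + a1 * a2 * a3
           * (2%:R * a7 * a8 * a9 + a0 * a4 * a7 + a0 * a5 * a8 + a0 * a6 * a9)
         + (a8 * a9 + a0 * a4) * (a9 * a7 + a0 * a5) * (a7 * a8 + a0 * a6))].

Definition hexahedron_at (K : fieldType) (n : nat)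
    (S : {set 'I_n}) (p q r : 'I_n) : seq (L' K n) :=
  let x := @x_set K n in
  let xf := @x_face K n in
  @hexahedron (L' K n)
    (* a0 *) (x (q |: S)%SET)
    (* a1 *) (xf S p q)
    (* a2 *) (- xf (q |: S)%SET p r)
    (* a3 *) (xf S q r)
    (* a4 *) (x (p |: S)%SET)
    (* a5 *) (- x (p |: (q |: (r |: S)))%SET)
    (* a6 *) (x (r |: S)%SET)
    (* a7 *) (- x (q |: (r |: S))%SET)
    (* a8 *) (x S)
    (* a9 *) (- x (p |: (q |: S))%SET)
    (* b0 *) (- x (p |: (r |: S))%SET)
    (* b1 *) (- xf (r |: S)%SET p q)
    (* b2 *) (xf S p r)
    (* b3 *) (- xf (p |: S)%SET q r).

(* The interval [S, S u D] with D = {p < q < r}. *)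
Definition hexahedron_relations (K : fieldType) (n : nat) : set (L' K n) :=
  [set f | exists (S : {set 'I_n}) (p q r : 'I_n),
     [/\ (p < q)%N, (q < r)%N, [/\ p \notin S, q \notin S & r \notin S]
       & f \in hexahedron_at K S p q r]].

(* Main.v *)
Require Import Defs.
From mathcomp Require Import all_boot all_order all_algebra.
From mathcomp Require Import fingroup perm finmap ring zify.
From mathcomp.multinomials Require Import monalg.

(** A generic matrix M can be recovered by rational operations from the minors
    attached to intervals: the principal minors of the intervals of [n], and
    the odd almost-principal minors of the faces <]i, j[; i, j> with i < j.
    These are n ^ 2 quantities, as many as the entries of M, and they
    label the vertices and faces of one rhombus tiling of the 2n-gon; call
    them the tile variables.  Two facts about them carry the proof.

    The tile variables are independent (realization): every assignment of
    nonzero values is attained.  The entries are found by increasing distance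
    |i - j| to the diagonal.  Given the smaller windows, the Schur complement
    with respect to ]i, j[ makes the face minor an affine function of one of
    the entries (i, j) and (j, i), and the principal minor of [i, j] an affine
    function of the other one.

    Every other variable is a rational function of the tile variables modulo
    the hexahedron relations alone (windows_generate, fraction_laurent).  In a
    cube S; p < q < r the relations can be solved, with monomial denominators,
    for x_Spr and the faces <S; p, r>, <Sr; p, q>, <Sp; q, r>; filling the gap
    q between p and r brings every set closer to an interval.  Hence for each
    Laurent polynomial f there are b and c in the tile variables, with b
    invertible modulo the ideal I of the relations, such that b f = c mod I.

    The relations hold for minors (minors_hexahedron): taking the Schur
    complement with respect to S reduces them to polynomial identities for a
    3 x 3 matrix.  So I is contained in J(V').  Conversely, if f vanishes on
    V', so does c; by independence c is zero, so b f, and therefore f, is in I.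

    Primality and the statement on V only use that minors restrict to
    polynomials on each line of the space of matrices.  Functions with this
    property have no zero divisors (linepoly_mul_neq0), which gives the
    density argument (density): an identity between minors that holds
    whenever all minors of the vector are nonzero holds whenever it makes
    sense. *)

Set Implicit Arguments.
Unset Strict Implicit.
Unset Printing Implicit Defensive.

Import Order.TTheory GRing.Theory Num.Theory.

Local Open Scope ring_scope.

(** * Determinants along lists of index pairs *)

Lemma det_reindex (R : comNzRingType) m (A : 'M[R]_m) (s t : 'S_m) :
  \det (\matrix_(k, l) A (s k) (t l)) = (-1) ^+ s * (-1) ^+ t * \det A.
Proof.
have -> : \matrix_(k, l) A (s k) (t l) = row_perm s (col_perm t A).
  by apply/matrixP=> k l; rewrite !mxE.
rewrite row_permE col_permE !det_mulmx !det_perm odd_permV.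
by rewrite [\det A * _]mulrC mulrA.
Qed.

Section PairDet.
Variables (K : fieldType) (T : eqType).
Implicit Types (F : T -> T -> K) (s t : seq (T * T)) (d : seq T).

(** The rows are the first components and the columns the second ones.  As
    the pairs can be permuted freely, no order of the indices has to be
    carried along; only the passage from sorted minors involves signs. *)
Definition pair_det F s : K :=
  \det (\matrix_(k < size s, l < size s)
    F (tnth (in_tuple s) k).1 (tnth (in_tuple s) l).2).

Definition diag d : seq (T * T) := [seq (x, x) | x <- d].

(** The form in which the dimension need not be literally the size of s. *)
Lemma pair_detE x0 m F s : size s = m ->
  pair_det F s = \det (\matrix_(k < m, l < m) F (nth x0 s k).1 (nth x0 s l).2).
Proof.
by move=> <-; congr (\det _); apply/matrixP=> k l; rewrite !mxE !(tnth_nth x0).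
Qed.

(** A common permutation of the rows and the columns contributes its sign
    twice. *)
Lemma pair_det_perm F s t : perm_eq s t -> pair_det F s = pair_det F t.
Proof.
move=> st; have sz := perm_size st.
have /tuple_permP[p /= Ep] : perm_eq s (in_tuple t) by [].
case: t => [|x0 t] in st sz p Ep *; first by rewrite (size0nil sz).
rewrite (pair_detE x0 F sz) (pair_detE x0 F (erefl _)).
rewrite -[RHS](signrMK p) mulrA -det_reindex.
congr (\det _); apply/matrixP=> k l; rewrite !mxE Ep.
by rewrite !(nth_map k) -?enumT ?size_enum_ord // !nth_ord_enum !(tnth_nth x0).
Qed.

Lemma eq_pair_det F F' s :
  {in [seq x.1 | x <- s] & [seq x.2 | x <- s], F =2 F'} -> pair_det F s = pair_det F' s.
Proof.
move=> FF'; congr (\det _); apply/matrixP=> k l; rewrite !mxE.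
by apply: FF'; apply: map_f; apply: mem_tnth.
Qed.

Lemma pair_det_tr F s : pair_det (fun x y => F y x) s = pair_det F [seq (x.2, x.1) | x <- s].
Proof.
case: s => [|x0 s]; first by rewrite /pair_det !det_mx00.
rewrite (pair_detE x0 _ (erefl _)) (@pair_detE (x0.2, x0.1) (size s).+1) ?size_map //.
rewrite -det_tr; congr (\det _); apply/matrixP=> k l; rewrite !mxE.
by rewrite !(nth_map x0 (x0.2, x0.1)).
Qed.

Lemma pair_det0 F : pair_det F [::] = 1.
Proof. exact: det_mx00. Qed.

Lemma pair_det1 F x : pair_det F [:: x] = F x.1 x.2.
Proof. by rewrite (pair_detE x F (erefl _)) det_mx11 !mxE. Qed.

Lemma pair_det2 F x y :
  pair_det F [:: x; y] = F x.1 x.2 * F y.1 y.2 - F x.1 y.2 * F y.1 x.2.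
Proof.
rewrite (pair_detE x F (erefl _)) (expand_det_row _ ord0) !big_ord_recl big_ord0.
rewrite /cofactor !det_mx11 !mxE /=; ring.
Qed.

Lemma pair_det3 F x y z :
  pair_det F [:: x; y; z] =
    F x.1 x.2 * (F y.1 y.2 * F z.1 z.2 - F y.1 z.2 * F z.1 y.2)
  - F x.1 y.2 * (F y.1 x.2 * F z.1 z.2 - F y.1 z.2 * F z.1 x.2)
  + F x.1 z.2 * (F y.1 x.2 * F z.1 y.2 - F y.1 y.2 * F z.1 x.2).
Proof.
rewrite (pair_detE x F (erefl _)) (expand_det_row _ ord0) !big_ord_recl big_ord0.
rewrite /cofactor !(expand_det_row _ ord0) !big_ord_recl !big_ord0.
rewrite /cofactor !det_mx11 !mxE /=; ring.
Qed.

(** The (x, y) entry of the Schur complement of the principal block on d. *)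
Definition schur F d x y : K :=
  F x y -
  ((\row_(l < size d) F x (tnth (in_tuple d) l)) *m
    invmx (\matrix_(k < size d, l < size d)
             F (tnth (in_tuple d) k) (tnth (in_tuple d) l)) *m
    (\col_(k < size d) F (tnth (in_tuple d) k) y)) 0 0.

Lemma pair_det_diag F d : pair_det F (diag d) =
  \det (\matrix_(k < size d, l < size d)
             F (tnth (in_tuple d) k) (tnth (in_tuple d) l)).
Proof.
case: d => [|x0 d]; first by rewrite pair_det0 det_mx00.
rewrite (@pair_detE (x0, x0) (size d).+1) ?size_map //.
congr (\det _); apply/matrixP=> k l; rewrite !mxE.
by rewrite !(nth_map x0) // !(tnth_nth x0).
Qed.

(** Block elimination: the columns of s can be cleared below by adding
    combinations of the columns of the invertible block d. *)
Lemma pair_det_schur F s d : pair_det F (diag d) != 0 ->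
  pair_det F (s ++ diag d) = pair_det F (diag d) * pair_det (schur F d) s.
Proof.
move=> d0; have [x0|s0] := boolP (nilp s); first by
  rewrite (nilP x0) pair_det0 mulr1.
case: s s0 => // x0 s' _; set s := x0 :: s'.
pose B := \matrix_(k < size s, l < size d) F (nth x0 s k).1 (tnth (in_tuple d) l).
pose C := \matrix_(k < size d, l < size s) F (tnth (in_tuple d) k) (nth x0 s l).2.
pose A := \matrix_(k < size s, l < size s) F (nth x0 s k).1 (nth x0 s l).2.
pose D := \matrix_(k < size d, l < size d)
             F (tnth (in_tuple d) k) (tnth (in_tuple d) l).
have uD : D \in unitmx by rewrite unitmxE -pair_det_diag unitfE.
have -> : pair_det F (s ++ diag d) = \det (block_mx A B C D).
  rewrite (@pair_detE x0 (size s + size d)) ?size_cat ?size_map //.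
  congr (\det _); apply/matrixP=> k l; rewrite !mxE.
  have E (j : 'I_(size d)) : nth x0 (s ++ diag d) (rshift (size s) j) =
      (tnth (in_tuple d) j, tnth (in_tuple d) j).
    rewrite nth_cat ltnNge leq_addr /= addKn (nth_map x0.1) //.
    by rewrite (tnth_nth x0.1).
  have E' (j : 'I_(size s)) : nth x0 (s ++ diag d) (lshift (size d) j) = nth x0 s j.
    by rewrite nth_cat /= ltn_ord.
  case: (split_ordP k) => k' ->; rewrite ?E ?E' !mxE;
  by case: (split_ordP l) => l' ->; rewrite ?E ?E' !mxE.
have : block_mx A B C D *m block_mx 1%:M 0 (- (invmx D *m C)) 1%:M =
    block_mx (A - B *m (invmx D *m C)) B 0 D.
  rewrite mulmx_block !mulmx1 !mulmx0 !mulmxN !add0r (mulmxA D) mulmxV //.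
  by rewrite mul1mx subrr.
move/(congr1 determinant); rewrite det_mulmx det_lblock !det1 !mulr1 => ->.
rewrite det_ublock mulrC pair_det_diag; congr (_ * _).
rewrite (pair_detE x0 _ (erefl _)); congr (\det _); apply/matrixP=> k l.
have E (X Y : 'M[K]_(size s)) : (X - Y) k l = X k l - Y k l by rewrite !mxE.
rewrite [RHS]mxE /schur mulmxA E [A k l]mxE.
congr (_ - _); rewrite !mxE; apply: eq_bigr => j _; rewrite !mxE.
by congr (_ * _); apply: eq_bigr => j' _; rewrite !mxE.
Qed.

(** The entry (x, y) enters the Schur complement only as an additive
    constant.  This is what allows solving for it. *)
Lemma eq_schur F F' d x y :
  {in x :: d & y :: d, forall u v, (u, v) != (x, y) -> F u v = F' u v} ->
  x \notin d -> y \notin d ->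
  schur F d x y - F x y = schur F' d x y - F' x y.
Proof.
move=> FF' xd yd; rewrite /schur [LHS]addrC addKr [RHS]addrC addKr.
congr (- (_ *m invmx _ *m _) _ _); apply/matrixP=> k l; rewrite !mxE.
- apply: FF'; rewrite ?mem_head ?inE ?mem_tnth ?orbT //.
  by apply/eqP=> -[E]; rewrite -E mem_tnth in yd.
- apply: FF'; rewrite ?inE ?mem_tnth ?orbT //.
  by apply/eqP=> -[_ E]; rewrite -E mem_tnth in yd.
- apply: FF'; rewrite ?mem_head ?inE ?mem_tnth ?orbT //.
  by apply/eqP=> -[E]; rewrite -E mem_tnth in xd.
Qed.

End PairDet.

(** * Sorted minors and their signs *)

Lemma minorE (K : comNzRingType) n (M : 'M[K]_n) m (A B : {set 'I_n}) x y :
  #|A| = m -> #|B| = m ->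
  minor M A B =
    \det (\matrix_(k < m, l < m) M (nth x (enum A) k) (nth y (enum B) l)).
Proof.
move=> <- AB; congr (\det _); apply/matrixP=> k l; rewrite !mxE (enum_val_nth x).
by congr (M _ _); apply: set_nth_default; rewrite -cardE AB.
Qed.

Lemma ltn_ord_neq n (x y : 'I_n) :
  (x < y)%N -> (x == y) = false /\ (y == x) = false.
Proof. by move=> xy; split; apply/eqP=> E; rewrite E ltnn in xy. Qed.

Section MinorSigns.
Variable n : nat.
Implicit Types (U : {set 'I_n}) (i j p q r x y : 'I_n).

(** The position of i when it is inserted into the sorted list of U. *)
Definition rank U i : nat := #|[set u in U | (u < i)%N]|.

(** The sign of moving i and j from their positions to the front. *)
Definition msign (K : nzRingType) U i j : K := (-1) ^+ rank U i * (-1) ^+ rank U j.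

Lemma rankU1 U x i : x \notin U -> rank (x |: U) i = ((x < i)%N + rank U i)%N.
Proof.
move=> xU; rewrite /rank; case: (ltnP x i) => xi.
  have -> : [set u in x |: U | (u < i)%N] = x |: [set u in U | (u < i)%N].
    by apply/setP=> u; rewrite !inE; case: eqP => [->|]; rewrite ?xi.
  by rewrite cardsU1 inE (negPf xU).
congr #|pred_of_set _|; apply/setP=> u; rewrite !inE; case: eqP => [->|//].
by rewrite (negPf xU) ltnNge xi.
Qed.

Lemma enumU1 U i : i \notin U ->
  exists s t, [/\ enum U = s ++ t, enum (i |: U) = s ++ i :: t & size s = rank U i].
Proof.
move=> iU; have : i \in enum 'I_n by rewrite mem_enum.
have : pairwise (fun x y : 'I_n => x < y)%N (enum 'I_n).
  rewrite -(@pairwise_map _ _ val ltn) val_enum_ord -sorted_pairwise.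
    exact: iota_ltn_sorted.
  exact: ltn_trans.
have -> : rank U i = count (fun u => (u \in U) && (u < i)%N) (enum 'I_n).
  rewrite /rank cardE [in LHS]/enum_mem size_filter -enumT.
  by apply: eq_count => u; rewrite !inE.
have E (A : {set 'I_n}) : enum A = filter (mem A) (enum 'I_n) by rewrite [in RHS]enumT.
rewrite (E U) (E (i |: U)).
move: (enum 'I_n) => e pw ie; case/splitPr: ie pw => e1 e2.
rewrite pairwise_cat /= => /and4P[/allrelP lt12 _ /allP lt2 _].
exists [seq u <- e1 | u \in U], [seq u <- e2 | u \in U].
have lt1 u : u \in e1 -> (u < i)%N by move=> ue; apply: lt12; rewrite // mem_head.
split; rewrite ?filter_cat /= ?inE ?(negPf iU) ?eqxx //.
  congr (_ ++ _ :: _); apply: eq_in_filter => u ue; rewrite !inE.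
    by have := lt1 _ ue; case: eqP => [->|//]; rewrite ltnn.
  by have := lt2 _ ue; case: eqP => [->|//]; rewrite ltnn.
rewrite count_cat /= (negPf iU) add0n size_filter -[LHS]addn0; congr addn.
  by apply: eq_in_count => u /lt1 ->; rewrite andbT.
apply/esym/eqP; rewrite -leqn0 leqNgt -has_count; apply/hasPn=> u /lt2 iu.
by rewrite negb_and orbC -leqNgt ltnW.
Qed.

Variable K : fieldType.
Implicit Types M : 'M[K]_n.

Lemma principal_minorE M U : principal_minor M U = pair_det M (diag (enum U)).
Proof.
rewrite pair_det_diag; have [->|[x xU]] := set_0Vmem U.
  have det0 m (A : 'M[K]_m) : m = 0%N -> \det A = 1.
    by move=> m0; case: _ / (esym m0) in A *; apply: det_mx00.
  by rewrite /principal_minor /minor !det0 ?enum_set0 ?cards0.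
rewrite /principal_minor (minorE _ x x (cardE U) (cardE U)); congr (\det _).
by apply/matrixP=> k l; rewrite !mxE !(tnth_nth x).
Qed.

(** The sorted rows and columns arise from the lists starting with i and j by
    a cycle each, whose sign is given by the rank. *)
Lemma almost_principal_minorE M U i j : i \notin U -> j \notin U ->
  almost_principal_minor M U i j =
    msign K U i j * pair_det M ((i, j) :: diag (enum U)).
Proof.
move=> iU jU.
have cU x : x \notin U -> #|x |: U| = #|U|.+1 by move=> xU; rewrite cardsU1 xU.
rewrite /almost_principal_minor (minorE M i j (cU _ iU) (cU _ jU)).
have key x : x \notin U -> exists a : 'I_#|U|.+1, a = rank U x :> nat /\
    forall k : 'I_#|U|.+1, nth x (enum (x |: U)) k =
      nth x (x :: enum U) (lift_perm a ord0 1 k).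
  move=> xU; have [s [t [EU ExU sr]]] := enumU1 xU.
  have aP : (rank U x < #|U|.+1)%N.
    by rewrite ltnS cardE EU size_cat sr leq_addr.
  exists (Ordinal aP); split=> // k; rewrite ExU EU.
  have [k'|] := unliftP (Ordinal aP) k => ->; last first.
    by rewrite lift_perm_id /= nth_cat sr ltnn subnn.
  rewrite lift_perm_lift perm1 /= -/(bump _ _) !nth_cat sr /bump.
  have [le|lt] := leqP (rank U x) k'; last by rewrite add0n lt.
  by rewrite add1n [(_.+1 < _)%N]ltnNge leqW //= subSn.
have [a [ra Ea]] := key i iU; have [b [rb Eb]] := key j jU.
transitivity (\det (\matrix_(k, l) (\matrix_(k < #|U|.+1, l < #|U|.+1)
    M (nth i (i :: enum U) k) (nth j (j :: enum U) l))
      (lift_perm a ord0 1 k) (lift_perm b ord0 1 l))).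
  by congr (\det _); apply/matrixP=> k l; rewrite !mxE Ea Eb.
rewrite det_reindex !odd_lift_perm !odd_perm1 !addbF /= !signr_odd /msign ra rb.
congr (_ * _); rewrite (@pair_detE _ _ (i, j) #|U|.+1) /= ?size_map -?cardE //.
congr (\det _); apply/matrixP=> k l; rewrite !mxE.
have E (z : 'I_n * 'I_n) (m : 'I_#|U|.+1) :
    nth z (z :: diag (enum U)) m =
      (nth z.1 (z.1 :: enum U) m, nth z.2 (z.2 :: enum U) m).
  case: m => -[|m] /=; first by case: z.
  rewrite ltnS cardE => lm; rewrite (nth_map z.1) //; congr (_, _).
  exact: set_nth_default.
by rewrite !E.
Qed.

(** Odd minors of sets of the two parities are read off from M and from its
    transpose; orient puts both cases on the same footing. *)
Definition orient M (b : bool) : 'I_n -> 'I_n -> K :=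
  fun x y => if b then M x y else M y x.

Lemma principal_minor_orient M b U :
  principal_minor M U = pair_det (orient M b) (diag (enum U)).
Proof.
by rewrite principal_minorE; case: b => //=; rewrite pair_det_tr -map_comp.
Qed.

Lemma orientN M b s :
  pair_det (orient M (~~ b)) s = pair_det (orient M b) [seq (z.2, z.1) | z <- s].
Proof. by case: b; rewrite /= -pair_det_tr. Qed.

Lemma odd_minorE M U i j : (i < j)%N -> i \notin U -> j \notin U ->
  odd_minor M U i j =
    msign K U i j * pair_det (orient M (odd #|U|)) ((i, j) :: diag (enum U)).
Proof.
move=> ij iU jU; rewrite /odd_minor /is_odd -signr_odd.
case: (odd _); rewrite ?expr1 ?expr0 ?mulr1 ?mulrN1 ?oppr_gt0 ?oppr_cp0.
  by rewrite subr_lt0 ltz_nat ij almost_principal_minorE.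
rewrite subr_gt0 ltz_nat ltnNge ltnW //= almost_principal_minorE //.
rewrite /msign [_ ^+ rank U j * _]mulrC; congr (_ * _).
by rewrite (orientN M true) /= -map_comp.
Qed.

(** * The hexahedron relations for minors *)

Lemma diag_enumU1 (S : {set 'I_n}) x : x \notin S ->
  perm_eq (diag (enum (x |: S))) ((x, x) :: diag (enum S)).
Proof.
move=> xS; rewrite -[_ :: _]/(diag (x :: enum S)); apply: perm_map.
apply: uniq_perm; rewrite /= ?enum_uniq ?mem_enum ?xS // => y.
by rewrite inE !mem_enum in_setU1.
Qed.

(** With x = det M_S and N the Schur complement of M_S, every minor of the
    cube is, up to sign, x times a minor of the 3 x 3 matrix N on p, q, r.
    Each relation is homogeneous, so the powers of x cancel, and every sign
    of p, q or r occurs an even number of times. *)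
Lemma minors_hexahedron M (S : {set 'I_n}) p q r :
  (p < q)%N -> (q < r)%N -> p \notin S -> q \notin S -> r \notin S ->
  principal_minor M S != 0 ->
  let x := principal_minor M in
  let xf := odd_minor M in
  hexahedron
    (x (q |: S)) (xf S p q) (- xf (q |: S) p r) (xf S q r) (x (p |: S))
    (- x (p |: (q |: (r |: S)))) (x (r |: S)) (- x (q |: (r |: S))) (x S)
    (- x (p |: (q |: S))) (- x (p |: (r |: S))) (- xf (r |: S) p q)
    (xf S p r) (- xf (p |: S) q r) = nseq 4 0.
Proof.
move=> pq qr pS qS rS xS0 /=.
have pr := ltn_trans pq qr.
have [npq _] := ltn_ord_neq pq; have [nqr _] := ltn_ord_neq qr.
have [npr _] := ltn_ord_neq pr.
pose b := odd #|S|; pose F := orient M b; pose d := diag (enum S).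
have dS0 : pair_det F d != 0 by rewrite -principal_minor_orient.
pose N := schur F (enum S).
have mcons (A : eqType) (z : A) s t : perm_eq s t -> perm_eq (z :: s) (z :: t).
  by rewrite perm_cons.
have cU x : x \notin S -> #|x |: S| = #|S|.+1 by move=> xU; rewrite cardsU1 xU.
have Ep x U : x \notin U -> principal_minor M (x |: U) =
    pair_det F ((x, x) :: diag (enum U)).
  by move=> xU; rewrite (principal_minor_orient _ b) (pair_det_perm _ (diag_enumU1 xU)).
have E0 : principal_minor M S = pair_det F d by exact: principal_minor_orient.
have E1 x : x \notin S -> principal_minor M (x |: S) = pair_det F d * pair_det N [:: (x, x)].
  by move=> xS; rewrite Ep // -pair_det_schur.
have E2 x y : x \notin S -> y \notin S -> x == y = false ->
    principal_minor M (x |: (y |: S)) = pair_det F d * pair_det N [:: (x, x); (y, y)].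
  move=> xS yS xy; rewrite Ep ?inE ?xy //.
  by rewrite (pair_det_perm _ (mcons _ _ _ _ (diag_enumU1 yS))) -pair_det_schur.
have E3 : principal_minor M (p |: (q |: (r |: S))) =
    pair_det F d * pair_det N [:: (p, p); (q, q); (r, r)].
  rewrite Ep ?inE ?nqr ?nqr ?npq ?npr //.
  have H := diag_enumU1 rS; have H' : q \notin r |: S by rewrite !inE nqr.
  rewrite (pair_det_perm _ (mcons _ _ _ _ (diag_enumU1 H'))).
  by rewrite (pair_det_perm _ (mcons _ _ _ _ (mcons _ _ _ _ H))) -pair_det_schur.
have O0 i j : (i < j)%N -> i \notin S -> j \notin S ->
    odd_minor M S i j = msign K S i j * (pair_det F d * pair_det N [:: (i, j)]).
  by move=> ij iS jS; rewrite odd_minorE // -pair_det_schur.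
have O1 k i j : (i < j)%N -> i \notin S -> j \notin S -> k \notin S ->
    i == k = false -> j == k = false -> odd_minor M (k |: S) i j =
    msign K (k |: S) i j * (pair_det F d * pair_det N [:: (j, i); (k, k)]).
  move=> ij iS jS kS ik jk; rewrite odd_minorE ?inE ?ik ?jk //.
  rewrite cU //= orientN /= -map_comp -pair_det_schur //.
  by rewrite (pair_det_perm _ (mcons _ _ _ _ (diag_enumU1 kS))).
rewrite E0 !E1 // !E2 // E3 !O0 // !O1 //; do ?by rewrite eq_sym.
(* Adding one of p, q, r to S changes the rank only of the larger ones; the
   only surviving change of sign is the one of <Sq; p, r>. *)
rewrite /msign !rankU1 // pq qr pr.
rewrite ![(_ < p)%N]ltnNge ![(_ < q)%N]ltnNge !(ltnW pq, ltnW pr, ltnW qr) /=.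
rewrite !add0n !add1n !exprS !mulN1r.
have sq (k : nat) : ((-1) ^+ k * (-1) ^+ k = 1 :> K) by rewrite -expr2 sqrr_sign.
have := sq (rank S p); have := sq (rank S q); have := sq (rank S r).
move: ((-1) ^+ rank S p) ((-1) ^+ rank S q) ((-1) ^+ rank S r) => ep eq er.
move=> hr hq hp.
rewrite /hexahedron !pair_det1 !pair_det2 pair_det3 /=.
move: (pair_det F d) => x.
move: (N p p) (N p q) (N p r) (N q p) (N q q) (N q r) (N r p) (N r q) (N r r).
move=> a1 a2 a3 b1 b2 b3 c1 c2 c3.
congr [:: _; _; _; _].
- ring: hp hq hr.
- ring: hp hq hr.
- ring: hp hq hr.
- ring: hp hq hr.
Qed.

End MinorSigns.

(** * Evaluation of Laurent polynomials *)

(** Stated for abstract rings and bare functions: evaluation is a ring morphism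
    only at nowhere-zero points. *)
Lemma map_hexahedron (A B : comNzRingType) (e : A -> B) :
  {morph e : x y / x + y} -> {morph e : x / - x} -> {morph e : x y / x * y} ->
  e 1 = 1 ->
  forall a0 a1 a2 a3 a4 a5 a6 a7 a8 a9 b0 b1 b2 b3,
  map e (hexahedron a0 a1 a2 a3 a4 a5 a6 a7 a8 a9 b0 b1 b2 b3) =
  hexahedron (e a0) (e a1) (e a2) (e a3) (e a4) (e a5) (e a6) (e a7) (e a8)
             (e a9) (e b0) (e b1) (e b2) (e b3).
Proof.
move=> eD eN eM e1 *.
by rewrite /hexahedron /= !expr2 !mulr2n !(eD, eN, eM, e1).
Qed.

Section LaurentEval.
Variables (I : finType) (K : fieldType).
Local Notation Lr := (laurent I K).
Local Notation expo := {ffun I -> int}.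
Implicit Types (f g : Lr) (v : I -> K) (k : expo).

Definition mono v k : K := \prod_i v i ^ k i.

Lemma monoD v k1 k2 : nowhere_zero v ->
  mono v (k1 + k2) = mono v k1 * mono v k2.
Proof.
move=> v0; rewrite /mono -big_split; apply: eq_bigr => i _.
by rewrite ffunE expfzDr.
Qed.

Lemma mono_neq0 v k : nowhere_zero v -> mono v k != 0.
Proof. by move=> v0; apply/prodf_neq0 => i _; rewrite expfz_neq0. Qed.

Lemma evalE v f : laurent_eval v f = \sum_(k <- msupp f) f@_k * mono v k.
Proof. by []. Qed.

Lemma evalU v c k : laurent_eval v << c *g k >> = c * mono v k.
Proof. by rewrite /laurent_eval (@mmapU _ _ _ idfun). Qed.

Lemma evalD v : {morph laurent_eval v : f g / f + g}.
Proof. exact: (@mmapD _ _ _ idfun). Qed.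

Lemma evalN v : {morph laurent_eval v : f / - f}.
Proof. exact: (@mmapN _ _ _ idfun). Qed.

Lemma eval0 v : laurent_eval v 0 = 0.
Proof. exact: (@mmap0 _ _ _ idfun). Qed.

Lemma eval_sum v (T : Type) (s : seq T) (F : T -> Lr) :
  laurent_eval v (\sum_(t <- s) F t) = \sum_(t <- s) laurent_eval v (F t).
Proof. exact: (big_morph _ (evalD v) (eval0 v)). Qed.

Lemma evalM v : nowhere_zero v -> {morph laurent_eval v : f g / f * g}.
Proof.
move=> v0 f g; rewrite -[f * g]/(laurent_mul f g) /laurent_mul eval_sum.
rewrite !evalE mulr_suml; apply: eq_bigr => k1 _.
rewrite eval_sum mulr_sumr; apply: eq_bigr => k2 _.
by rewrite evalU monoD // mulrACA.
Qed.

Lemma eval1 v : laurent_eval v 1 = 1.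
Proof.
rewrite -[1]/(<< 0%R >> : Lr) evalU mul1r /mono big1 // => i _.
by rewrite ffunE expr0z.
Qed.

Lemma eval_var v i : laurent_eval v (laurent_var K i) = v i.
Proof.
rewrite evalU mul1r /mono (bigD1 i) //= ffunE eqxx expr1z big1 ?mulr1 // => j.
by rewrite ffunE eq_sym => /negPf ->.
Qed.

Lemma eval_hexahedron v : nowhere_zero v ->
  forall a0 a1 a2 a3 a4 a5 a6 a7 a8 a9 b0 b1 b2 b3 : Lr,
  let e := laurent_eval v in
  map e (hexahedron a0 a1 a2 a3 a4 a5 a6 a7 a8 a9 b0 b1 b2 b3) =
  hexahedron (e a0) (e a1) (e a2) (e a3) (e a4) (e a5) (e a6) (e a7) (e a8)
             (e a9) (e b0) (e b1) (e b2) (e b3).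
Proof.
move=> v0 *; apply: map_hexahedron; [exact: evalD|exact: evalN|exact: evalM|].
exact: eval1.
Qed.

End LaurentEval.

Lemma eval_rename (I I' : finType) (K : fieldType) (h : I -> I')
    (v : I' -> K) (f : laurent I K) : nowhere_zero v ->
  laurent_eval v (laurent_rename h f) = laurent_eval (v \o h) f.
Proof.
move=> v0; rewrite /laurent_rename eval_sum evalE; apply: eq_bigr => k _.
rewrite evalU; congr (_ * _); rewrite /mono.
rewrite (partition_big h xpredT) //=; apply: eq_bigr => i' _.
rewrite ffunE; transitivity (\prod_(i | h i == i') v i' ^ k i); last first.
  by apply: eq_bigr => i /eqP <-.
by apply: (big_morph (fun m => v i' ^ m)) => [a b|]; [rewrite expfzDr ?v0|rewrite expr0z].
Qed.

Lemma exp2z_inj (K : numFieldType) : injective (exprz (2 : K)).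
Proof.
have exp1 (m : nat) : (2 : K) ^+ m = 1 -> m = 0%N.
  by move/eqP; rewrite -natrX pnatr_eq1 -(expn0 2) eqn_exp2l // => /eqP.
have u2 : (2 : K) != 0 by rewrite pnatr_eq0.
move=> a b ab; apply/eqP; rewrite -subr_eq0.
have : (2 : K) ^ (a - b) = 1 by rewrite expfzDr // -invr_expz ab mulfV // expfz_neq0.
case: (a - b) => m; first by rewrite -exprnP => /exp1 ->.
by rewrite NegzE -exprz_inv -exprnP exprVn => /eqP; rewrite invr_eq1 => /eqP/exp1.
Qed.

(** Monomials are distinct characters of the torus, and distinct characters
    are linearly independent (Dedekind). *)
Lemma laurent_torus0 (I : finType) (K : numFieldType) (f : laurent I K) :
  (forall v : I -> K, nowhere_zero v -> laurent_eval v f = 0) -> f = 0.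
Proof.
move=> f0.
have char : forall (s : seq {ffun I -> int}) (c : {ffun I -> int} -> K),
    uniq s ->
    (forall v : I -> K, nowhere_zero v -> \sum_(k <- s) c k * mono v k = 0) ->
    forall k, k \in s -> c k = 0.
  elim=> [//|k0 s IHs] c /= /andP[k0s us] c0.
  have cs k : k \in s -> c k = 0.
    move=> ks; have [i ki] : exists i, k i != k0 i.
      apply/existsP; apply: contraNT k0s; rewrite negb_exists => /forallP E.
      suff <- : k = k0 by [].
      by apply/ffunP=> i; apply/eqP; rewrite -[_ == _]negbK.
    (* The translate by w multiplies the two characters by different powers of
       2, so that subtracting a multiple of the relation removes k0 only. *)
    pose w j : K := if j == i then 2 else 1.
    have w0 : nowhere_zero w.
      by move=> j; rewrite /w; case: ifP; rewrite ?oner_eq0 ?pnatr_eq0.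
    have ww k' : mono w k' = 2 ^ k' i.
      rewrite /mono (bigD1 i) //= /w eqxx big1 ?mulr1 // => j /negPf ->.
      by rewrite exp1rz.
    have : (mono w k - mono w k0) * c k = 0.
      apply: (IHs (fun k => (mono w k - mono w k0) * c k)) => // v v0.
      have vw0 : nowhere_zero (fun j => w j * v j).
        by move=> j; rewrite mulf_neq0 ?w0 ?v0.
      have mw k' : mono (fun j => w j * v j) k' = mono w k' * mono v k'.
        by rewrite /mono -big_split; apply: eq_bigr => j _; rewrite expfzMl.
      have := c0 _ vw0; have := c0 _ v0; rewrite !big_cons mw => E1 E2.
      have {}E1 : c k0 * mono v k0 = - \sum_(k <- s) c k * mono v k.
        by apply/eqP; rewrite -addr_eq0 E1.
      move: E2; rewrite mulrCA E1 mulrN mulr_sumr -sumrN -big_split /= => E2.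
      rewrite -[RHS]E2; apply: eq_bigr => k' _; rewrite mw; ring.
    move/eqP; rewrite mulf_eq0 => /orP[|/eqP //].
    by rewrite !ww subr_eq0 => /eqP/exp2z_inj E; rewrite E eqxx in ki.
  move=> k; rewrite inE => /orP[/eqP ->|]; last exact: cs.
  have one0 : nowhere_zero (fun _ : I => 1 : K) by move=> j; rewrite oner_eq0.
  have := c0 _ one0; rewrite big_cons big_seq big1 ?addr0 => [|k' /cs ->].
    by move/eqP; rewrite mulf_eq0 (negPf (mono_neq0 _ one0)) orbF => /eqP.
  by rewrite mul0r.
apply/malgP=> k; rewrite mcoeff0; have [kf|/mcoeff_outdom //] := boolP (k \in msupp f).
apply: (char (msupp f) (fun k => f@_k)) => [|v /f0|//]; first exact: fset_uniq.
by rewrite evalE.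
Qed.

(** * Functions that are polynomial on lines *)

Section LinePolynomial.
Variables (K : numFieldType) (W : lmodType K).
Implicit Types F G : W -> K.

(** Stands for polynomial functions on W: restricting to the line through two
    points is all that is needed to see that there are no zero divisors. *)
Definition linepoly F : Prop :=
  forall x y : W, exists p : {poly K}, forall t, F (x + t *: y) = p.[t].

Lemma eq_linepoly F G : F =1 G -> linepoly F -> linepoly G.
Proof. by move=> FG lF x y; have [p pE] := lF x y; exists p => t; rewrite -FG. Qed.

Lemma linepoly_const (c : K) : linepoly (fun=> c).
Proof. by move=> x y; exists c%:P => t; rewrite hornerC. Qed.

Lemma linepolyD F G : linepoly F -> linepoly G -> linepoly (fun x => F x + G x).
Proof.
move=> lF lG x y; have [p pE] := lF x y; have [q qE] := lG x y.
by exists (p + q) => t; rewrite hornerD pE qE.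
Qed.

Lemma linepolyM F G : linepoly F -> linepoly G -> linepoly (fun x => F x * G x).
Proof.
move=> lF lG x y; have [p pE] := lF x y; have [q qE] := lG x y.
by exists (p * q) => t; rewrite hornerM pE qE.
Qed.

Lemma linepolyX F m : linepoly F -> linepoly (fun x => F x ^+ m).
Proof.
move=> lF; elim: m => [|m IHm].
  by apply: eq_linepoly (linepoly_const 1) => x; rewrite expr0.
by apply: eq_linepoly (linepolyM lF IHm) => x; rewrite exprS.
Qed.

Lemma linepoly_sum (T : Type) (s : seq T) (F : T -> W -> K) :
  (forall t, linepoly (F t)) -> linepoly (fun x => \sum_(t <- s) F t x).
Proof.
move=> lF; elim: s => [|t s IHs].
  by apply: eq_linepoly (linepoly_const 0) => x; rewrite big_nil.
by apply: eq_linepoly (linepolyD (lF t) IHs) => x; rewrite big_cons.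
Qed.

Lemma linepoly_prod (T : Type) (s : seq T) (F : T -> W -> K) :
  (forall t, linepoly (F t)) -> linepoly (fun x => \prod_(t <- s) F t x).
Proof.
move=> lF; elim: s => [|t s IHs].
  by apply: eq_linepoly (linepoly_const 1) => x; rewrite big_nil.
by apply: eq_linepoly (linepolyM (lF t) IHs) => x; rewrite big_cons.
Qed.

Lemma poly_nonroot (p : {poly K}) : p != 0 -> exists t, p.[t] != 0.
Proof.
move=> p0; pose s : seq K := [seq i%:R | i <- iota 0 (size p)].
have us : uniq s by rewrite map_inj_uniq ?iota_uniq //; exact: mulrIn (oner_neq0 _).
have : ~~ all (root p) s.
  apply/negP=> /(max_poly_roots p0)/(_ us).
  by rewrite size_map size_iota ltnn.
by case/allPn=> t _; exists t.
Qed.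

(** On the line through x and y both functions are nonzero polynomials, whose
    product is nonzero somewhere because K is infinite. *)
Lemma linepoly_mul_neq0 F G x y : linepoly F -> linepoly G ->
  F x != 0 -> G y != 0 -> exists z, F z * G z != 0.
Proof.
move=> lF lG Fx Gy.
have [p pE] := lF x (y - x); have [q qE] := lG x (y - x).
have p0 : p != 0.
  apply: contraNneq Fx => p0; have := pE 0.
  by rewrite scale0r addr0 p0 horner0 => ->.
have q0 : q != 0.
  apply: contraNneq Gy => q0; have := qE 1.
  by rewrite scale1r addrC subrK q0 horner0 => ->.
have [t] := poly_nonroot (mulf_neq0 p0 q0).
by rewrite hornerM -pE -qE; exists (x + t *: (y - x)).
Qed.

Lemma linepoly_prod_neq0 (T : finType) (F : T -> W -> K) :
  (forall t, linepoly (F t)) -> (forall t, exists x, F t x != 0) ->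
  exists x, forall t, F t x != 0.
Proof.
move=> lF F0; suff [x Px] : exists x, \prod_t F t x != 0.
  by exists x => t; move/prodf_neq0: Px => /(_ t isT).
elim: (index_enum T) => [|t s [x IHs]].
  by exists 0; rewrite big_nil oner_eq0.
have [y Fy] := F0 t.
have [z Fz] := linepoly_mul_neq0 (lF t) (linepoly_prod s lF) Fy IHs.
by exists z; rewrite big_cons.
Qed.

(** Multiplying by a high power of the product of all coordinates turns a
    Laurent polynomial into a polynomial with the same zeros on the torus. *)
Lemma linepoly_clear (J : finType) (c : W -> J -> K) (f : laurent J K) :
  (forall j, linepoly (fun x => c x j)) ->
  exists2 G, linepoly G & forall x, nowhere_zero (c x) ->
    (G x == 0) = (laurent_eval (c x) f == 0).
Proof.
move=> lc.
(* An upper bound for the absolute values of all exponents. *)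
pose N : nat := \sum_(k <- msupp f) \sum_j absz (k j).
exists (fun x => \sum_(k <- msupp f)
    f@_k * \prod_j c x j ^+ absz ((k : {ffun J -> int}) j + N)).
  apply: linepoly_sum => k; apply: linepolyM; first exact: linepoly_const.
  by apply: linepoly_prod => j; apply: linepolyX.
move=> x c0; pose P := \prod_j c x j ^+ N.
have P0 : P != 0 by apply/prodf_neq0 => j _; rewrite expf_neq0.
rewrite -[in RHS](inj_eq (mulIf P0)) mul0r evalE mulr_suml; congr (_ == _).
rewrite !big_seq; apply: eq_bigr => k kf; rewrite -mulrA; congr (_ * _).
rewrite -big_split; apply: eq_bigr => j _ /=.
rewrite [_ ^+ N]exprnP -expfzDr // [_ ^+ absz _]exprnP gez0_abs //.
have : (absz (k j) <= N)%N.
  rewrite /N (big_rem k) //= (bigD1 j) //= -addnA; exact: leq_addr.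
move: (k j) (N) => a m; lia.
Qed.

End LinePolynomial.

(** * Fractions modulo an ideal *)

Section Fractions.
(** B is the subring of the possible numerators and denominators. *)
Variables (A : comNzRingType) (I B : A -> Prop).
Hypotheses (I0 : I 0) (ID : forall x y, I x -> I y -> I (x + y))
  (IM : forall a x, I x -> I (a * x)).
Hypotheses (B1 : B 1) (BN1 : B (- 1))
  (BD : forall x y, B x -> B y -> B (x + y))
  (BM : forall x y, B x -> B y -> B (x * y)).

Definition unit_mod u : Prop := exists w, I (u * w - 1).

(** In the quotient by I, f is a quotient of two elements of B. *)
Definition fraction f : Prop := exists b c, [/\ B b, B c, unit_mod b & I (b * f - c)].

Lemma unit_modM u v : unit_mod u -> unit_mod v -> unit_mod (u * v).
Proof.
move=> [u' Iu] [v' Iv]; exists (u' * v').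
have -> : u * v * (u' * v') - 1 = (v * v') * (u * u' - 1) + 1 * (v * v' - 1) by ring.
by apply: ID; apply: IM.
Qed.

Lemma unit_mod1 : unit_mod 1.
Proof. by exists 1; rewrite mulr1 subrr. Qed.

Lemma unit_modN u : unit_mod u -> unit_mod (- u).
Proof. by move=> [w Iw]; exists (- w); rewrite mulrNN. Qed.

Lemma fraction_base f : B f -> fraction f.
Proof.
by move=> Bf; exists 1, f; split=> //; [exact: unit_mod1 | rewrite mul1r subrr].
Qed.

Lemma fractionM f g : fraction f -> fraction g -> fraction (f * g).
Proof.
move=> [b [c [Bb Bc ub If]]] [b' [c' [Bb' Bc' ub' Ig]]].
exists (b * b'), (c * c'); split; try exact: BM; first exact: unit_modM.
have -> : b * b' * (f * g) - c * c' = (b' * g) * (b * f - c) + c * (b' * g - c').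
  by ring.
by apply: ID; apply: IM.
Qed.

Lemma fractionD f g : fraction f -> fraction g -> fraction (f + g).
Proof.
move=> [b [c [Bb Bc ub If]]] [b' [c' [Bb' Bc' ub' Ig]]].
exists (b * b'), (b' * c + b * c'); split.
- exact: BM.
- by apply: BD; apply: BM.
- exact: unit_modM.
have -> : b * b' * (f + g) - (b' * c + b * c') =
    b' * (b * f - c) + b * (b' * g - c') by ring.
by apply: ID; apply: IM.
Qed.

Lemma fraction1 : fraction 1. Proof. exact: fraction_base. Qed.

Lemma fractionN f : fraction f -> fraction (- f).
Proof. by move=> ef; rewrite -mulN1r; apply: fractionM => //; apply: fraction_base. Qed.

Lemma fraction_opp f : fraction (- f) -> fraction f.
Proof. by move/fractionN; rewrite opprK. Qed.

Lemma fractionX f m : fraction f -> fraction (f ^+ m).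
Proof.
move=> ef; elim: m => [|m IHm]; first by rewrite expr0; apply: fraction1.
by rewrite exprS; apply: fractionM.
Qed.

(** If u f = g mod I, with u = c / b and g = c' / b', then f = b c' / (b' c);
    here c is invertible since u and b are. *)
Lemma fraction_div u f g :
  unit_mod u -> fraction u -> fraction g -> I (u * f - g) -> fraction f.
Proof.
move=> [w Iw] [b [c [Bb Bc [b1 Ib1] Ib]]] [b' [c' [Bb' Bc' ub' Ig]]] If.
exists (b' * c), (b * c'); split; try exact: BM.
  apply: unit_modM => //; exists (b1 * w).
  have -> : c * (b1 * w) - 1 =
      - (b1 * w) * (b * u - c) + (u * w) * (b * b1 - 1) + 1 * (u * w - 1) by ring.
  by apply: ID; first apply: ID; apply: IM.
have -> : b' * c * f - b * c' =
    - (b' * f) * (b * u - c) + (b * b') * (u * f - g) + b * (b' * g - c') by ring.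
by apply: ID; first apply: ID; apply: IM.
Qed.

(** The relations are linear in the starred quantities, with coefficients
    that are monomials in a0, a1, a2, a3. *)
Lemma fraction_hexahedron a0 a1 a2 a3 a4 a5 a6 a7 a8 a9 b0 b1 b2 b3 :
  (forall f, f \in hexahedron a0 a1 a2 a3 a4 a5 a6 a7 a8 a9 b0 b1 b2 b3 -> I f) ->
  unit_mod a0 -> unit_mod a1 -> unit_mod a2 -> unit_mod a3 ->
  fraction a0 -> fraction a1 -> fraction a2 -> fraction a3 ->
  fraction a7 -> fraction a8 -> fraction a9 ->
  [/\ fraction a4 -> fraction b1, fraction a5 -> fraction b2, fraction a6 -> fraction b3
    & fraction a4 -> fraction a5 -> fraction a6 -> fraction b0].
Proof.
move=> hI u0 u1 u2 u3 e0 e1 e2 e3 e7 e8 e9.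
have h i : (i < 4)%N -> I (nth 0 (hexahedron a0 a1 a2 a3 a4 a5 a6 a7 a8 a9 b0 b1 b2 b3) i).
  by move=> i4; apply: hI; apply: mem_nth.
have e2r : fraction 2%:R by exact: (fractionD fraction1 fraction1).
split=> [e4|e5|e6|e4 e5 e6].
- apply: (@fraction_div (a1 * a0) b1 _); last first.
  + have -> : a1 * a0 * b1 = b1 * a1 * a0 by ring.
    exact: (h 0%N isT).
  + by repeat first [apply: fractionD | apply: fractionM].
  + exact: fractionM.
  + exact: unit_modM.
- apply: (@fraction_div (a2 * a0) b2 _); last first.
  + have -> : a2 * a0 * b2 = b2 * a2 * a0 by ring.
    exact: (h 1%N isT).
  + by repeat first [apply: fractionD | apply: fractionM].
  + exact: fractionM.
  + exact: unit_modM.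
- apply: (@fraction_div (a3 * a0) b3 _); last first.
  + have -> : a3 * a0 * b3 = b3 * a3 * a0 by ring.
    exact: (h 2%N isT).
  + by repeat first [apply: fractionD | apply: fractionM].
  + exact: fractionM.
  + exact: unit_modM.
- apply: (@fraction_div (a0 ^+ 2 * a1 * a2 * a3) b0 _); last first.
  + have -> : a0 ^+ 2 * a1 * a2 * a3 * b0 = b0 * a0 ^+ 2 * a1 * a2 * a3 by ring.
    exact: (h 3%N isT).
  + by repeat first [exact e2r | apply: fractionD | apply: fractionM | apply: fractionX].
  + by repeat first [exact e2r | apply: fractionD | apply: fractionM | apply: fractionX].
  + by rewrite expr2; repeat apply: unit_modM.
Qed.

(** The signs are those of the substitution of minors. *)
Lemma fraction_signed_hexahedron a0 a1 a2 a3 a4 a5 a6 a7 a8 a9 b0 b1 b2 b3 :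
  (forall f, f \in hexahedron a0 a1 (- a2) a3 a4 (- a5) a6 (- a7) a8 (- a9)
                     (- b0) (- b1) b2 (- b3) -> I f) ->
  unit_mod a0 -> unit_mod a1 -> unit_mod a2 -> unit_mod a3 ->
  fraction a0 -> fraction a1 -> fraction a2 -> fraction a3 ->
  fraction a7 -> fraction a8 -> fraction a9 ->
  [/\ fraction a4 -> fraction b1, fraction a5 -> fraction b2, fraction a6 -> fraction b3
    & fraction a4 -> fraction a5 -> fraction a6 -> fraction b0].
Proof.
move=> hI u0 u1 /unit_modN u2 u3 e0 e1 /fractionN e2 e3 /fractionN e7 e8 /fractionN e9.
have [h1 h2 h3 h0] := fraction_hexahedron hI u0 u1 u2 u3 e0 e1 e2 e3 e7 e8 e9.
split=> [/h1/fraction_opp|/fractionN/h2|/h3/fraction_opp|e4 /fractionN e5 e6] //.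
by apply: fraction_opp; apply: h0.
Qed.

End Fractions.

(** * Generators of the Laurent polynomial ring *)

Section LaurentGen.
Variables (I : finType) (K : fieldType).
Local Notation Lr := (laurent I K).
Local Notation expo := {ffun I -> int}.

Definition laurent_varV (i : I) : Lr := << - [ffun j => (i == j)%:Z] >>.

Lemma laurent_varK i : laurent_var K i * laurent_varV i = 1.
Proof.
rewrite -[LHS]/(laurent_mul _ _) laurent_mulUU mulr1 subrr //.
Qed.

(** The variables and their inverses generate the ring of Laurent
    polynomials. *)
Lemma laurent_ind (D : Lr -> Prop) :
  (forall c, D << c *g 0 >>) ->
  (forall f g, D f -> D g -> D (f + g)) ->
  (forall f g, D f -> D g -> D (f * g)) ->
  (forall i, D (laurent_var K i)) -> (forall i, D (laurent_varV i)) ->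
  forall f, D f.
Proof.
move=> Dc DD DM Dv DV f; rewrite [f]monalgE.
have D0 : D 0 by have := Dc 0; rewrite monalgU0.
apply: (big_ind D) => // k _; move: f@_k => c.
have MU (k1 k2 : expo) (c1 c2 : K) :
    << c1 * c2 *g k1 + k2 >> = (<< c1 *g k1 >> : Lr) * << c2 *g k2 >>.
  by rewrite -[RHS]/(laurent_mul _ _) laurent_mulUU.
rewrite -[k]add0r -[c]mulr1 MU; apply: (DM) => //.
have -> : k = \sum_i [ffun j => (i == j)%:Z] *~ k i.
  apply/ffunP=> j; rewrite sum_ffunE (bigD1 j) //= big1 ?addr0 => [|i /negPf ij].
    by rewrite ffunMzE ffunE eqxx intz.
  by rewrite ffunMzE ffunE ij mul0rz.
apply: (big_ind (fun k => D << k >>)) => [|k1 k2 D1 D2|i _]; first exact: Dc.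
  by rewrite -[1]mulr1 MU; apply: (DM).
have Dm (k1 : expo) m : D << k1 >> -> D << k1 *+ m >>.
  move=> D1; elim: m => [|m IHm]; first exact: Dc.
  by rewrite mulrS -[1]mulr1 MU; apply: (DM).
case: (k i) => m; first exact/Dm/Dv.
by rewrite NegzE mulrNz -mulNrz; apply/Dm/DV.
Qed.

End LaurentGen.

(** * Filling gaps by cubes *)

Section Windows.
Variable n : nat.
Implicit Types (S U : {set 'I_n}) (i j p q r x y : 'I_n).

(** The bounds are natural numbers rather than indices, so that the empty
    window and the whole of [n] are covered. *)
Definition window (a b : nat) : {set 'I_n} := [set x : 'I_n | (a <= x < b)%N].

Lemma windowP a b x : (x \in window a b) = (a <= x < b)%N.
Proof. by rewrite inE. Qed.

Lemma sub_windowU1 a b x U :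
  (x |: U \subset window a b) = (a <= x < b)%N && (U \subset window a b).
Proof. by rewrite subUset sub1set windowP. Qed.

Lemma sub_window a b a' b' U : (a' <= a)%N -> (b <= b')%N ->
  U \subset window a b -> U \subset window a' b'.
Proof.
move=> aa bb /subsetP sU; apply/subsetP=> x /sU; rewrite !windowP; lia.
Qed.

Lemma notin_window a b U x : U \subset window a b -> ~~ (a <= x < b)%N -> x \notin U.
Proof. by move=> /subsetP sU; apply: contra => /sU; rewrite windowP. Qed.

(** V and F stand for the vertices and faces already expressed by tile
    variables; cube is what the four hexahedron relations provide. *)
Variables (V : {set 'I_n} -> Prop) (F : {set 'I_n} -> 'I_n -> 'I_n -> Prop).
Hypothesis V_window : forall a b, V (window a b).
Hypothesis F_window : forall i j, (i < j)%N -> F (window i.+1 j) i j.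
Hypothesis cube : forall S p q r, (p < q)%N -> (q < r)%N ->
  p \notin S -> q \notin S -> r \notin S ->
  V (q |: S) -> F S p q -> F (q |: S) p r -> F S q r ->
  V (q |: (r |: S)) -> V S -> V (p |: (q |: S)) ->
  [/\ V (p |: S) -> F (r |: S) p q,
      V (p |: (q |: (r |: S))) -> F S p r,
      V (r |: S) -> F (p |: S) q r
    & V (p |: S) -> V (p |: (q |: (r |: S))) -> V (r |: S) ->
      V (p |: (r |: S))].

Definition holds_within a b : Prop :=
  (forall U, U \subset window a b -> V U) /\
  (forall U i j, (i < j)%N -> i \notin U -> j \notin U ->
     U \subset window a b -> (a <= i)%N -> (j < b)%N -> F U i j).

Section Step.
(** The window with ends p0 and r0, assuming the two windows obtained by
    dropping one of the ends. *)
Variables p0 r0 : 'I_n.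
Hypothesis p0r0 : (p0 < r0)%N.
Hypotheses (Wl : holds_within p0 r0) (Wr : holds_within p0.+1 r0.+1).
Local Notation inner := (window p0.+1 r0).

(** A cube with p = p0 and r = r0: apart from <Sq; p0, r0>, all the input
    lies in a shorter window. *)
Lemma cube_ends S q : S \subset inner -> (p0 < q)%N -> (q < r0)%N -> q \notin S ->
  F (q |: S) p0 r0 ->
  [/\ V (p0 |: S) -> F (r0 |: S) p0 q,
      V (p0 |: (q |: (r0 |: S))) -> F S p0 r0,
      V (r0 |: S) -> F (p0 |: S) q r0
    & V (p0 |: S) -> V (p0 |: (q |: (r0 |: S))) -> V (r0 |: S) ->
      V (p0 |: (r0 |: S))].
Proof.
move=> SW pq qr qS e2.
have SWl := sub_window (leqnSn p0) (leqnn r0) SW.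
have SWr := sub_window (leqnn p0.+1) (leqnSn r0) SW.
have pS : p0 \notin S by apply: (notin_window SW); rewrite ltnn.
have rS : r0 \notin S by apply: (notin_window SW); rewrite ltnn andbF.
apply: cube => //.
- by apply: Wl.1; rewrite sub_windowU1 SWl; lia.
- by apply: Wl.2.
- by apply: Wr.2.
- by apply: Wr.1; rewrite !sub_windowU1 SWr; lia.
- exact: Wl.1.
- by apply: Wl.1; rewrite !sub_windowU1 SWl; lia.
Qed.

(** Induction on the number of gaps: the cube over a gap q expresses the
    vertex and the face for S by those for q |: S. *)
Lemma holds_ends S : S \subset inner ->
  V (p0 |: (r0 |: S)) /\ F S p0 r0.
Proof.
have [m] := ubnP #|inner :\: S|; elim: m S => // m IHm S.
rewrite ltnS => Sm SW; have [WS|] := boolP (inner \subset S).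
  have -> : S = inner by apply/eqP; rewrite eqEsubset SW.
  split; last exact: F_window.
  have -> : p0 |: (r0 |: inner) = window p0 r0.+1; last exact: V_window.
  by apply/setP=> x; rewrite !inE -!val_eqE /=; lia.
case/subsetPn=> q qW qS; have := qW; rewrite windowP => /andP[pq qr].
have [||e5 e2] := IHm (q |: S).
- apply: leq_trans Sm; apply: proper_card; rewrite properE setDS ?subsetUr //=.
  by apply/subsetPn; exists q; rewrite !inE ?eqxx ?qS // -windowP.
- by rewrite sub_windowU1 pq qr.
have SWl := sub_window (leqnSn p0) (leqnn r0) SW.
have SWr := sub_window (leqnn p0.+1) (leqnSn r0) SW.
have [_ h2 _ h0] := cube_ends SW pq qr qS e2.
have e5' : V (p0 |: (q |: (r0 |: S))) by rewrite (setUCA [set q]).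
split; last exact: h2.
apply: h0 => //; [apply: Wl.1 | apply: Wr.1]; rewrite sub_windowU1 ?SWl ?SWr; lia.
Qed.

(** Faces of sets that contain exactly one of the ends p0 and r0, the other one
    being a corner of the face; the cube uses holds_ends for q |: S. *)
Lemma holds_one_end S q : S \subset inner -> (p0 < q < r0)%N -> q \notin S ->
  F (r0 |: S) p0 q /\ F (p0 |: S) q r0.
Proof.
move=> SW /andP[pq qr] qS.
have SWl := sub_window (leqnSn p0) (leqnn r0) SW.
have SWr := sub_window (leqnn p0.+1) (leqnSn r0) SW.
have [_ e2] : V (p0 |: (r0 |: (q |: S))) /\ F (q |: S) p0 r0.
  by apply: holds_ends; rewrite sub_windowU1 pq qr.
have [h1 _ h3 _] := cube_ends SW pq qr qS e2.
split; [apply: h1; apply: Wl.1 | apply: h3; apply: Wr.1];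
  rewrite sub_windowU1 ?SWl ?SWr; lia.
Qed.

(** Faces of sets that contain both ends: the cube over p0 |: S with third
    direction r0 uses two faces of holds_one_end. *)
Lemma holds_both_ends S i j : S \subset inner -> (p0 < i)%N -> (i < j)%N -> (j < r0)%N ->
  i \notin S -> j \notin S -> F (p0 |: (r0 |: S)) i j.
Proof.
move=> SW pi ij jr iS jS.
have [_ nip] := ltn_ord_neq pi; have [_ njp] := ltn_ord_neq (ltn_trans pi ij).
have [_ nrp] := ltn_ord_neq p0r0; have [nij _] := ltn_ord_neq ij.
have rS : r0 \notin S by apply: (notin_window SW); rewrite ltnn andbF.
have SWl := sub_window (leqnSn p0) (leqnn r0) SW.
have ir := ltn_trans ij jr; have pj := ltn_trans pi ij.
have iW : (p0 < i < r0)%N by rewrite pi ir.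
have jW : (p0 < j < r0)%N by rewrite pj jr.
have pSl : p0 |: S \subset window p0 r0 by rewrite sub_windowU1 SWl leqnn p0r0.
have [_ e2] : F (r0 |: (j |: S)) p0 i /\ F (p0 |: (j |: S)) i r0.
  by apply: holds_one_end => //; rewrite ?sub_windowU1 ?jW // !inE nij.
have [_ e3] := holds_one_end SW jW jS.
have [e7 _] : V (p0 |: (r0 |: (j |: S))) /\ F (j |: S) p0 r0.
  by apply: holds_ends; rewrite sub_windowU1 jW.
have [||||||||||h1 _ _ _] := @cube (p0 |: S) i j r0 ij jr;
  rewrite ?in_setU1 ?nip ?njp ?nrp //.
- by apply: Wl.1; rewrite sub_windowU1 pSl (ltnW pj) jr.
- by apply: Wl.2 => //; rewrite ?in_setU1 ?nip ?njp // ltnW.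
- by rewrite setUCA.
- by move: e7; rewrite setUCA (setUCA [set p0]) setUCA.
- exact: Wl.1.
- by apply: Wl.1; rewrite 2!sub_windowU1 pSl (ltnW pi) ir (ltnW pj) jr.
rewrite setUCA; apply: h1; apply: Wl.1.
by rewrite sub_windowU1 pSl (ltnW pi) ir.
Qed.

End Step.

Lemma sub_window_left a b U : U \subset window a b ->
  ~~ [exists x in U, x == a :> nat] -> U \subset window a.+1 b.
Proof.
move=> /subsetP sU /existsPn nU; apply/subsetP=> x xU; rewrite windowP.
by have := nU x; have := sU _ xU; rewrite windowP xU; lia.
Qed.

Lemma sub_window_right a b U : U \subset window a b.+1 ->
  ~~ [exists x in U, x == b :> nat] -> U \subset window a b.
Proof.
move=> /subsetP sU /existsPn nU; apply/subsetP=> x xU; rewrite windowP.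
by have := nU x; have := sU _ xU; rewrite windowP xU; lia.
Qed.

Lemma setU1_D1 U x : x \in U -> exists2 S, U = x |: S & x \notin S.
Proof. by move=> xU; exists (U :\ x); rewrite ?setD1K // setD11. Qed.

Lemma sub_inner x y S a b : S \subset window a b.+1 -> x = a :> nat -> y = b :> nat ->
  x \notin S -> y \notin S -> S \subset window x.+1 y.
Proof.
move=> /subsetP sS xa yb xS yS; apply/subsetP=> z zS; have := sS _ zS.
have zx : z != x :> nat by apply: contraNneq xS => /val_inj <-.
have zy : z != y :> nat by apply: contraNneq yS => /val_inj <-.
by rewrite !windowP; lia.
Qed.

(** Induction on the length of the window.  A vertex or face that misses one
    of the ends lies in a shorter window; otherwise the position of the ends
    selects one of the three preceding lemmas. *)
Lemma holds_within_all w a : holds_within a (a + w).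
Proof.
elim: w a => [|w IHw] a.
  rewrite addn0; split=> [U sU|U i j ij iU jU _ ai ja]; last by lia.
  suff -> : U = window a a by apply: V_window.
  by apply/eqP; rewrite eqEsubset sU; apply/subsetP=> x; rewrite windowP; lia.
have Wl := IHw a; have Wr := IHw a.+1.
rewrite addnS; rewrite addSn in Wr.
split=> [U sU|U i j ij iU jU sU ai jb].
  have [/exists_inP[p pU /eqP pa]|nU] := boolP [exists x in U, x == a :> nat]; last first.
    by apply: Wr.1; apply: sub_window_left.
  have [/exists_inP[r rU /eqP ra]|nU] := boolP [exists x in U, x == (a + w)%N :> nat];
    last by apply: Wl.1; apply: sub_window_right.
  rewrite -ra -pa in sU Wl Wr.
  have [w0|w0] := posnP w.
    have -> : U = window p r.+1; last exact: V_window.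
    apply/eqP; rewrite eqEsubset sU /=; apply/subsetP=> x; rewrite windowP => xpr.
    by suff -> : x = p by []; apply: val_inj => /=; lia.
  have pr : (p < r)%N by lia.
  have [S ES pS] := setU1_D1 pU; subst U.
  have {}rU : r \in S by move: rU; rewrite in_setU1 -val_eqE /=; case: eqP => //; lia.
  have [T ET rT] := setU1_D1 rU; subst S.
  have {}pT : p \notin T by apply: contra pS => pT; rewrite in_setU1 pT orbT.
  have {}sU : T \subset window p.+1 r.
    apply: (sub_inner _ (erefl (p : nat)) (erefl (r : nat)) pT rT).
    by move: sU; rewrite !sub_windowU1 => /and3P[].
  by case: (holds_ends pr Wl Wr sU).
have [aU|aU] := boolP (~~ [exists x in U, x == a :> nat] && (i != a :> nat)).
  case/andP: aU => aU ia; apply: Wr.2 => //; last by lia.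
  exact: sub_window_left.
have [bU|bU] := boolP (~~ [exists x in U, x == (a + w)%N :> nat] && (j != (a + w)%N :> nat)).
  case/andP: bU => bU jw; apply: Wl.2 => //; last by lia.
  exact: sub_window_right.
rewrite negb_and negbK in aU; rewrite negb_and negbK in bU.
have [ia|ia] := eqVneq (i : nat) a; have [jw|jw] := eqVneq (j : nat) (a + w)%N.
- rewrite -jw -ia in Wl Wr.
  by case: (holds_ends ij Wl Wr (sub_inner sU ia jw iU jU)).
- rewrite jw orbF in bU; case/exists_inP: bU => r rU /eqP ra.
  have [S ES rS] := setU1_D1 rU; subst U.
  rewrite -ra -ia in Wl Wr sU.
  have ir : (i < r)%N by lia.
  move: iU jU; rewrite !in_setU1 !negb_or => /andP[_ iS] /andP[_ jS].
  case: (@holds_one_end i r ir Wl Wr S j) => //; last by rewrite ij; lia.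
  apply: (sub_inner _ (erefl (i : nat)) (erefl (r : nat)) iS rS).
  by move: sU; rewrite !sub_windowU1 => /andP[].
- rewrite ia orbF in aU; case/exists_inP: aU => p pU /eqP pa.
  have [S ES pS] := setU1_D1 pU; subst U.
  rewrite -jw -pa in Wl Wr sU.
  have pj : (p < j)%N by lia.
  move: iU jU; rewrite !in_setU1 !negb_or => /andP[_ iS] /andP[_ jS].
  case: (@holds_one_end p j pj Wl Wr S i) => //; last by rewrite ij; lia.
  apply: (sub_inner _ (erefl (p : nat)) (erefl (j : nat)) pS jS).
  by move: sU; rewrite !sub_windowU1 => /andP[].
rewrite jw orbF in bU; case/exists_inP: bU => r rU /eqP ra.
rewrite ia orbF in aU; case/exists_inP: aU => p pU /eqP pa.
have pr : (p < r)%N by lia.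
rewrite -ra -pa in Wl Wr sU.
have [S ES pS] := setU1_D1 pU; subst U.
have {}rU : r \in S by move: rU; rewrite in_setU1 -val_eqE /=; case: eqP => //; lia.
have [T ET rT] := setU1_D1 rU; subst S.
have {}pT : p \notin T by apply: contra pS => pT; rewrite in_setU1 pT orbT.
move: iU jU; rewrite !in_setU1 !negb_or => /and3P[_ _ iS] /and3P[_ _ jS].
apply: (holds_both_ends pr Wl Wr) => //; try lia.
apply: (sub_inner _ (erefl (p : nat)) (erefl (r : nat)) pT rT).
by move: sU; rewrite !sub_windowU1 => /and3P[].
Qed.

Lemma windows_generate :
  (forall U, V U) /\
  (forall U i j, (i < j)%N -> i \notin U -> j \notin U -> F U i j).
Proof.
have sub U : U \subset window 0 n by apply/subsetP=> x _; rewrite windowP /=.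
have [WV WF] := holds_within_all n 0.
by split=> [U|U i j ij iU jU]; [apply: WV | apply: WF].
Qed.

End Windows.

(** * Prescribing the minors of intervals *)

Section Realization.
Variables (n : nat) (K : fieldType).
Implicit Types (i j x y : 'I_n) (M : 'M[K]_n).

Lemma card_window a k : (a + k <= n)%N -> #|window n a (a + k)| = k.
Proof.
elim: k => [|k IHk] akn.
  apply/eqP; rewrite cards_eq0; apply/eqP/setP=> x; rewrite !inE; lia.
rewrite addnS in akn *; pose z := Ordinal akn.
have -> : window n a (a + k).+1 = z |: window n a (a + k).
  by apply/setP=> x; rewrite !inE -val_eqE /=; lia.
by rewrite cardsU1 inE ltnn andbF IHk // ltnW.
Qed.

Variables (u : {set 'I_n} -> K) (w : 'I_n -> 'I_n -> K).
Hypotheses (u0 : forall U, u U != 0) (w0 : forall i j, w i j != 0).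
Hypothesis u_set0 : u set0 = 1.

(** The minors of all windows of at most d elements have the prescribed
    values. *)
Definition realizes d M : Prop :=
  (forall a b, (b <= a + d)%N -> principal_minor M (window n a b) = u (window n a b)) /\
  (forall i j, (i < j)%N -> (j < i + d)%N -> odd_minor M (window n i.+1 j) i j = w i j).

Lemma realizes_local d M M' :
  (forall x y, (x < y + d)%N -> (y < x + d)%N -> M x y = M' x y) ->
  realizes d M -> realizes d M'.
Proof.
move=> MM' [Mu Mw]; split=> [a b ab|i j ij jid].
  rewrite -Mu // !principal_minorE; apply: eq_pair_det => x y.
  rewrite -!map_comp !map_id !mem_enum !windowP => xab yab.
  by rewrite MM' //; lia.
rewrite -Mw // !odd_minorE ?windowP ?ltnn ?andbF //; congr (_ * _).
apply: eq_pair_det => x y /=.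
rewrite -!map_comp !map_id !inE !mem_enum !windowP -!val_eqE /orient /= => xab yab.
by case: odd; rewrite MM' //; lia.
Qed.

(** The entries at distance d from the diagonal do not enter the windows of
    d elements, and for d > 0 each window of d + 1 elements contains just two
    of them, at opposite corners.  So they can be changed for all these
    windows at the same time. *)
Lemma realizes_step d M : realizes d M -> exists M', realizes d.+1 M'.
Proof.
move=> rM; have [Mu Mw] := rM; have [d0|d0] := posnP d.
  subst d; exists (\matrix_(x, y) u [set x]); split=> [a b|i j ij jid]; last by lia.
  rewrite addn1 leq_eqVlt => /orP[/eqP ->|]; last first.
    rewrite ltnS => ba; have -> : window n a b = set0.
      by apply/setP=> x; rewrite !inE; lia.
    by rewrite principal_minorE enum_set0 pair_det0 u_set0.
  have [an|na] := ltnP a n; last first.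
    have -> : window n a a.+1 = set0.
      by apply/setP=> x; rewrite !inE; have := ltn_ord x; lia.
    by rewrite principal_minorE enum_set0 pair_det0 u_set0.
  have -> : window n a a.+1 = [set Ordinal an].
    by apply/setP=> x; rewrite !inE -val_eqE /=; lia.
  by rewrite principal_minorE enum_set1 pair_det1 mxE.
(* Face minors for windows of d + 1 elements all have d - 1 common indices, so
   that one orientation serves them all. *)
pose b := odd d.-1; pose F := orient M b.
pose S i j := window n i.+1 j.
pose C i j x y := schur F (enum (S i j)) x y - F x y.
(* The values that the Schur complement must take at (i, j) and (j, i); G
   subtracts the known additive constants. *)
pose al i j := w i j / (msign K (S i j) i j * u (S i j)).
pose be i j := (schur F (enum (S i j)) i i * schur F (enum (S i j)) j j
                - u (window n i j.+1) / u (S i j)) / al i j.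
pose G x y := if y == (x + d)%N :> nat then al x y - C x y x y
              else if x == (y + d)%N :> nat then be y x - C y x x y
              else F x y.
pose M' := \matrix_(x, y) if b then G x y else G y x.
have GE x y : orient M' b x y = G x y by rewrite /orient; case: ifP => bb; rewrite mxE bb.
have GF x y : (x < y + d)%N -> (y < x + d)%N -> G x y = F x y.
  by move=> xy yx; rewrite /G !ifF //; apply/eqP; lia.
have MM' x y : (x < y + d)%N -> (y < x + d)%N -> M x y = M' x y.
  move=> xy yx; rewrite mxE; have := GF _ _ xy yx; have := GF _ _ yx xy.
  by rewrite /F /orient; case: (b).
exists M'; have [M'u M'w] := realizes_local MM' rM.
have key i j : j = (i + d)%N :> nat ->
    odd_minor M' (window n i.+1 j) i j = w i j /\
    principal_minor M' (window n i j.+1) = u (window n i j.+1).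
  move=> jid; have ij : (i < j)%N by lia.
  have iS : i \notin S i j by rewrite windowP ltnn.
  have jS : j \notin S i j by rewrite windowP ltnn andbF.
  have dS : pair_det G (diag (enum (S i j))) = u (S i j).
    rewrite -M'u; last by lia.
    rewrite (principal_minor_orient _ b); apply: eq_pair_det => x y _ _.
    by rewrite GE.
  have dS0 : pair_det G (diag (enum (S i j))) != 0 by rewrite dS.
  have cS : #|S i j| = d.-1.
    have := @card_window i.+1 d.-1; rewrite addSn -addnS prednK // -jid.
    by apply; apply: ltnW.
  have ms0 : msign K (S i j) i j != 0 by rewrite mulf_neq0 ?signr_eq0.
  have al0 : al i j != 0 := mulf_neq0 (w0 i j) (invr_neq0 (mulf_neq0 ms0 (u0 _))).
  have schE x y : x \in [:: i; j] -> y \in [:: i; j] ->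
      schur G (enum (S i j)) x y = G x y + C i j x y.
    move=> xij yij.
    have end_notin z : z \in [:: i; j] -> z \notin enum (S i j).
      by rewrite mem_enum !inE => /orP[] /eqP ->; rewrite ?ltnn ?andbF.
    suff E : schur G (enum (S i j)) x y - G x y = C i j x y.
      by rewrite -E addrC subrK.
    apply: eq_schur; [move=> s t|exact: end_notin..].
    move: xij yij; rewrite !in_cons !mem_enum !windowP !in_nil !orbF.
    rewrite xpair_eqE -!val_eqE /= => xij yij sx ty st.
    by apply: GF; lia.
  have zd (z : nat) : (z < z + d)%N by rewrite -{1}[z]addn0 ltn_add2l.
  have Nii : schur G (enum (S i j)) i i = schur F (enum (S i j)) i i.
    by rewrite schE ?mem_head // GF // /C addrC subrK.
  have Njj : schur G (enum (S i j)) j j = schur F (enum (S i j)) j j.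
    by rewrite schE ?inE ?eqxx ?orbT // GF // /C addrC subrK.
  have Nij : schur G (enum (S i j)) i j = al i j.
    by rewrite schE ?inE ?eqxx ?orbT // /G jid eqxx subrK.
  have Nji : schur G (enum (S i j)) j i = be i j.
    rewrite schE ?inE ?eqxx ?orbT // /G jid ifF ?eqxx ?subrK //.
    by apply/eqP; lia.
  split.
    rewrite odd_minorE // -/(S i j) cS -/b.
    have -> : pair_det (orient M' b) ((i, j) :: diag (enum (S i j))) =
        pair_det G ([:: (i, j)] ++ diag (enum (S i j))).
      by apply: eq_pair_det => x y _ _; rewrite GE.
    rewrite pair_det_schur // pair_det1 /= Nij dS /al.
    have cancel (a c e : K) : a != 0 -> c != 0 -> a * (c * (e / (a * c))) = e.
      by move=> a0 c0; field; rewrite ?a0 ?c0.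
    exact: cancel.
  have -> : principal_minor M' (window n i j.+1) =
      pair_det G ([:: (i, i); (j, j)] ++ diag (enum (S i j))).
    have jiS : i \notin j |: S i j.
      by rewrite in_setU1 negb_or iS andbT -val_eqE /=; lia.
    have -> : window n i j.+1 = i |: (j |: S i j).
      by apply/setP=> x; rewrite !inE -!val_eqE /=; lia.
    rewrite (principal_minor_orient _ b).
    rewrite (pair_det_perm _ (diag_enumU1 jiS)).
    have := diag_enumU1 jS; rewrite -(perm_cons (i, i)) => /(pair_det_perm _) ->.
    by apply: eq_pair_det => x y _ _; rewrite GE.
  rewrite pair_det_schur // pair_det2 /= Nii Njj Nij Nji dS /be.
  by rewrite [al i j * _]mulrC divfK // subKr [u _ * _]mulrC divfK.
split=> [a c|i j ij]; last first.
  rewrite addnS ltnS leq_eqVlt => /orP[/eqP/key[] //|]; exact: M'w.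
rewrite addnS leq_eqVlt => /orP[/eqP ->|]; last by rewrite ltnS; apply: M'u.
have [adn|nad] := ltnP (a + d) n; last first.
  have -> : window n a (a + d).+1 = window n a (a + d).
    by apply/setP=> x; rewrite !inE; have := ltn_ord x; lia.
  exact: M'u.
have an : (a < n)%N by lia.
by have [] := @key (Ordinal an) (Ordinal adn) (erefl _).
Qed.

Lemma realization : exists M,
  (forall a b, principal_minor M (window n a b) = u (window n a b)) /\
  (forall i j, (i < j)%N -> odd_minor M (window n i.+1 j) i j = w i j).
Proof.
have ex d : exists M, realizes d M.
  elim: d => [|d [M /realizes_step //]].
  exists 0; split=> [a b ab|i j ij]; last by lia.
  have -> : window n a b = set0 by apply/setP=> x; rewrite !inE; lia.
  by rewrite principal_minorE enum_set0 pair_det0 u_set0.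
have [M [Mu Mw]] := ex n.
exists M; split=> [a b|i j ij]; last by apply: Mw => //; have := ltn_ord j; lia.
have [bn|nb] := leqP b n; first by apply: Mu; lia.
suff -> : window n a b = window n a n by apply: Mu; lia.
by apply/setP=> x; rewrite !inE; have := ltn_ord x; lia.
Qed.

End Realization.

(** * Density of matrices with nonzero minors *)

Section MinorVectors.
Variables (K : numFieldType) (n : nat).
Implicit Types (M : 'M[K]_n) (i j x y : 'I_n) (U : {set 'I_n}).

Lemma linepoly_det m (f g : 'I_m -> 'I_m -> 'I_n) :
  linepoly (fun M => \det (\matrix_(k < m, l < m) M (f k l) (g k l))).
Proof.
move=> M N.
exists (\det (\matrix_(k < m, l < m)
   ((M (f k l) (g k l))%:P + (N (f k l) (g k l))%:P * 'X))) => t.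
rewrite -horner_evalE -det_map_mx; congr (\det _); apply/matrixP=> k l.
by rewrite !mxE /= /horner_eval !hornerE mulrC.
Qed.

Lemma linepoly_minor (A C : {set 'I_n}) : linepoly (fun M => minor M A C).
Proof. exact: linepoly_det. Qed.

Lemma linepoly_minor_vector z : linepoly (fun M => minor_vector M z).
Proof.
case: z => [U|t]; first exact: linepoly_minor.
rewrite /minor_vector /odd_minor.
by case: (is_odd (val t).1 (val t).2.1 (val t).2.2); apply: linepoly_minor.
Qed.

Lemma pair_det_delta (F : 'I_n -> 'I_n -> K) U :
  {in U &, forall x y, F x y = (x == y)%:R} -> pair_det F (diag (enum U)) = 1.
Proof.
move=> FU; rewrite pair_det_diag -[RHS](det1 K (size (enum U))).
have inU k : tnth (in_tuple (enum U)) k \in U by rewrite -(mem_enum U) mem_tnth.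
congr (\det _); apply/matrixP=> k l; rewrite 2!mxE (FU _ _ (inU k) (inU l)).
congr (_%:R); have /tuple_uniqP tI : uniq (in_tuple (enum U)) by apply: enum_uniq.
by rewrite (inj_eq tI).
Qed.

(** The identity matrix does it for principal minors.  For a face, an
    additional entry 1 at (i, j) or (j, i), depending on the parity of U, makes
    the submatrix an identity matrix up to the order of its rows. *)
Lemma minor_vector_neq0 z : exists M, minor_vector M z != 0.
Proof.
case: z => [U|[[U [i j]] /= fU]].
  exists 1%:M; rewrite /minor_vector principal_minorE pair_det_delta ?oner_eq0 //.
  by move=> x y _ _; rewrite mxE.
have /and3P[/= ij iU jU] := fU.
pose F x y : K := (x == y)%:R + ((x == i) && (y == j))%:R.
exists (\matrix_(x, y) if odd #|U| then F x y else F y x).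
rewrite odd_minorE // mulf_neq0 ?mulf_neq0 ?signr_eq0 //.
have -> : pair_det (orient (\matrix_(x, y) (if odd #|U| then F x y else F y x)) (odd #|U|))
    ((i, j) :: diag (enum U)) = pair_det F ([:: (i, j)] ++ diag (enum U)).
  by apply: eq_pair_det => x y _ _; rewrite /orient; case: ifP => b; rewrite mxE b.
have ne x : x \in U -> (i == x) = false /\ (x == i) = false /\ (x == j) = false.
  move=> xU; split; [|split]; apply/eqP=> E; last 2 first.
  - by rewrite -E xU in iU.
  - by rewrite -E xU in jU.
  by rewrite E xU in iU.
have FU : {in U &, forall x y, F x y = (x == y)%:R}.
  by move=> x y xU yU; rewrite /F (ne x xU).2.1 addr0.
rewrite pair_det_schur pair_det_delta ?oner_eq0 // mul1r pair_det1 /schur.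
have -> : \row_(l < size (enum U)) F i (tnth (in_tuple (enum U)) l) = 0.
  apply/matrixP=> k l; rewrite !mxE.
  have xU : tnth (in_tuple (enum U)) l \in U by rewrite -(mem_enum U) mem_tnth.
  by rewrite /F (ne _ xU).1 (ne _ xU).2.2 andbF addr0.
have nij : (i == j) = false by apply/eqP=> E; rewrite E ltnn in ij.
by rewrite !mul0mx mxE subr0 /F !eqxx nij add0r oner_eq0.
Qed.

(** F and each of the minors are polynomial on lines and not identically zero,
    so their product is not identically zero. *)
Lemma generic_matrix (F : 'M[K]_n -> K) : linepoly F -> (exists M, F M != 0) ->
  exists M, F M != 0 /\ nowhere_zero (minor_vector M).
Proof.
move=> lF [M FM].
have [N N0] := linepoly_prod_neq0 linepoly_minor_vector minor_vector_neq0.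
have lP := linepoly_prod (index_enum (var_index n)) linepoly_minor_vector.
have P0 : \prod_z minor_vector N z != 0 by apply/prodf_neq0 => z _; apply: N0.
have [Q] := linepoly_mul_neq0 lF lP FM P0.
rewrite mulf_eq0 negb_or => /andP[FQ /prodf_neq0 Q0].
by exists Q; split=> // z; apply: Q0.
Qed.

(** Where c is nowhere zero but some minor vanishes, f is still zero: otherwise
    its cleared form would be nonzero at a generic matrix as well. *)
Lemma density (J : finType) (c : 'M[K]_n -> J -> K) (f : laurent J K) :
  (forall z, linepoly (fun M => c M z)) ->
  (forall M, nowhere_zero (minor_vector M) -> nowhere_zero (c M) ->
     laurent_eval (c M) f = 0) ->
  forall M, nowhere_zero (c M) -> laurent_eval (c M) f = 0.
Proof.
move=> lc f0 M cM; apply/eqP; apply: contraT => fM.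
have [G lG GE] := linepoly_clear f lc.
have lP := linepoly_prod (index_enum J) lc.
have [|N [GN N0]] := generic_matrix (linepolyM lG lP).
  by exists M; rewrite mulf_neq0 ?GE //; apply/prodf_neq0 => z _; apply: cM.
move: GN; rewrite mulf_eq0 negb_or => /andP[GN /prodf_neq0 cN].
have {}cN : nowhere_zero (c N) by move=> z; apply: cN.
by rewrite GE // f0 // eqxx in GN.
Qed.

Lemma eval_x_set M U : laurent_eval (minor_vector M) (x_set K U) = principal_minor M U.
Proof.
rewrite /x_set; case: insubP => [z _ <-|]; first exact: eval_var.
rewrite negbK => /eqP ->.
by rewrite eval1 principal_minorE enum_set0 pair_det0.
Qed.

Lemma eval_x_face M U i j : (i < j)%N -> i \notin U -> j \notin U ->
  laurent_eval (minor_vector M) (x_face K U i j) = odd_minor M U i j.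
Proof.
move=> ij iU jU; rewrite /x_face; case: insubP => [z _ E|].
  by rewrite eval_var /minor_vector E.
by rewrite /is_face /= ij iU jU.
Qed.

Lemma hexahedron_vanish f v : @hexahedron_relations K n f -> @V' K n v ->
  laurent_eval v f = 0.
Proof.
move=> [S [p [q [r [pq qr [pS qS rS] fh]]]]] [v0 [M vM]]; subst v.
have [npq nqp] := ltn_ord_neq pq; have [nqr nrq] := ltn_ord_neq qr.
have pr := ltn_trans pq qr; have [npr nrp] := ltn_ord_neq pr.
have xS : principal_minor M S != 0.
  have [->|S0] := eqVneq S set0.
    by rewrite principal_minorE enum_set0 pair_det0 oner_eq0.
  exact: (v0 (inl (Sub S S0))).
have := map_f (laurent_eval (minor_vector M)) fh.
rewrite eval_hexahedron // !evalN !eval_x_set.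
rewrite !eval_x_face ?in_setU1 ?npq ?nrq ?nqr ?nqp ?npr ?nrp //.
by rewrite minors_hexahedron // => /nseqP[].
Qed.

End MinorVectors.

Local Open Scope classical_set_scope.

(** * The ideal of the hexahedron relations *)

Section IdealGen.
Variables (A : comNzRingType) (G : set A).

Lemma ideal_gen0 : ideal_gen G 0.
Proof. by exists [::]; split=> [t //|]; rewrite big_nil. Qed.

Lemma ideal_genD f g : ideal_gen G f -> ideal_gen G g -> ideal_gen G (f + g).
Proof.
move=> [s [sG ->]] [t [tG ->]]; exists (s ++ t); split; last by rewrite big_cat.
by move=> x; rewrite mem_cat => /orP[/sG|/tG].
Qed.

Lemma ideal_genM f g : ideal_gen G g -> ideal_gen G (f * g).
Proof.
move=> [s [sG ->]]; exists [seq (f * t.1, t.2) | t <- s]; split.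
  by move=> x /mapP[t /sG ? ->].
by rewrite big_map mulr_sumr; apply: eq_bigr => t _; rewrite mulrA.
Qed.

Lemma ideal_gen_mem f : G f -> ideal_gen G f.
Proof.
move=> Gf; exists [:: (1, f)]; split; last by rewrite big_seq1 mul1r.
by move=> t; rewrite inE => /eqP ->.
Qed.

End IdealGen.

Section Generation.
Variables (K : numFieldType) (n : nat).
Local Notation A := (L' K n).
Local Notation J := (vanishing_ideal (@V' K n)).
Local Notation I := (ideal_gen (@hexahedron_relations K n)).

Lemma ideal_vanish f : I f -> J f.
Proof.
move=> [s [sG ->]] v Vv; rewrite eval_sum big_seq big1 // => t /sG Gt.
by rewrite evalM ?(hexahedron_vanish Gt) ?mulr0 //; case: Vv.
Qed.

Lemma x_setP (U : {set 'I_n}) :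
  x_set K U = 1 \/ exists2 z : pindex n, val z = U & x_set K U = laurent_var K (inl z).
Proof. by rewrite /x_set; case: insubP => [z _ zE|_]; [right; exists z | left]. Qed.

Lemma x_faceE (U : {set 'I_n}) (i j : 'I_n) :
  (i < j)%N -> i \notin U -> j \notin U ->
  exists2 t : face n, val t = (U, (i, j)) & x_face K U i j = laurent_var K (inr t).
Proof.
move=> ij iU jU; rewrite /x_face; case: insubP => [t _ tE|]; first by exists t.
by rewrite /is_face /= ij iU jU.
Qed.

Definition tile (z : var_index n) : Prop :=
  match z with
  | inl U => exists a b, val U = window n a b
  | inr t => (val t).1 = window n (val t).2.1.+1 (val t).2.2
  end.

(** Laurent polynomials in the tile variables, described by their values;
    this makes the closure properties immediate. *)
Definition on_tiles (f : A) : Prop :=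
  forall v w : var_index n -> K, nowhere_zero v -> nowhere_zero w ->
  (forall z, tile z -> v z = w z) -> laurent_eval v f = laurent_eval w f.

Lemma on_tiles_const c : on_tiles << c *g 0 >>.
Proof.
move=> v w _ _ _; rewrite !evalU; congr (_ * _).
by apply: eq_bigr => i _; rewrite ffunE !expr0z.
Qed.

Lemma on_tilesD f g : on_tiles f -> on_tiles g -> on_tiles (f + g).
Proof. by move=> Bf Bg v w v0 w0 vw; rewrite !evalD (Bf v w) ?(Bg v w). Qed.

Lemma on_tilesM f g : on_tiles f -> on_tiles g -> on_tiles (f * g).
Proof. by move=> Bf Bg v w v0 w0 vw; rewrite !evalM // (Bf v w) ?(Bg v w). Qed.

Lemma on_tiles_var z : tile z -> on_tiles (laurent_var K z).
Proof. by move=> tz v w v0 w0 vw; rewrite !eval_var vw. Qed.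

Lemma on_tiles1 : on_tiles 1.
Proof. by move=> v w _ _ _; rewrite !eval1. Qed.

Lemma on_tilesN1 : on_tiles (- 1).
Proof. by move=> v w _ _ _; rewrite !evalN !eval1. Qed.

Lemma realize_tiles (v : var_index n -> K) : nowhere_zero v ->
  exists M : 'M[K]_n, forall z, tile z -> minor_vector M z = v z.
Proof.
move=> v0.
pose u (U : {set 'I_n}) :=
  if (insub U : option (pindex n)) is Some z then v (inl z) else 1.
pose w (i j : 'I_n) :=
  if (insub (window n i.+1 j, (i, j)) : option (face n)) is Some t
  then v (inr t) else 1.
have u0 U : u U != 0 by rewrite /u; case: insubP => [z _ _|_]; rewrite ?v0 ?oner_eq0.
have w0 i j : w i j != 0.
  by rewrite /w; case: insubP => [z _ _|_]; rewrite ?v0 ?oner_eq0.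
have uset0 : u finset.set0 = 1 by rewrite /u insubF // eqxx.
have [M [Mu Mw]] := realization u0 w0 uset0.
exists M => -[U [a [b UE]]|t /= tE].
  by rewrite /minor_vector UE Mu -UE /u valK.
case: t tE => -[S [i j]] /= ft SE; subst S.
have /and3P[/= ij _ _] := ft.
by rewrite Mw // /w insubT; congr (v (inr _)); apply: val_inj.
Qed.

(** Independence of the tile variables.  The matrix realizing given values may
    have other minors equal to zero, hence the density argument, applied to
    the vector of minors with all coordinates outside the tiles replaced
    by 1. *)
Lemma vanish_on_tiles f : on_tiles f -> J f -> f = 0.
Proof.
move=> Bf Jf; apply: laurent_torus0 => v v0.
have [M Mv] := realize_tiles v0.
pose c (M : 'M[K]_n) z : K := if `[< tile z >] then minor_vector M z else 1.
have cM z : tile z -> c M z = v z by move=> tz; rewrite /c asboolT // Mv.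
have c0 : nowhere_zero (c M).
  by move=> z; rewrite /c; case: asboolP => [/Mv ->|_]; rewrite ?v0 ?oner_eq0.
rewrite -(Bf (c M) v) //; apply: (density (c := c)) => // [z|N N0 cN].
  rewrite /c; case: `[< tile z >]; first exact: linepoly_minor_vector.
  exact: linepoly_const.
rewrite (Bf (c N) (minor_vector N)) // => [|z tz]; last by rewrite /c asboolT.
by apply: Jf; split=> //; exists N.
Qed.

(** The variables by windows_generate, hence everything: the inverse of a
    variable z solves z f = 1. *)
Lemma fraction_laurent f : fraction I on_tiles f.
Proof.
pose I0 := @ideal_gen0 _ (@hexahedron_relations K n).
pose ID := @ideal_genD _ (@hexahedron_relations K n).
pose IM := @ideal_genM _ (@hexahedron_relations K n).
have unit_var z : unit_mod I (laurent_var K z).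
  by exists (laurent_varV K z); rewrite laurent_varK subrr.
have unit_set U : unit_mod I (x_set K U).
  by have [->|[z _ ->]] := x_setP U; [apply: (unit_mod1 I0) | apply: unit_var].
have unit_face (U : {set 'I_n}) (i j : 'I_n) : (i < j)%N -> i \notin U -> j \notin U ->
    unit_mod I (x_face K U i j).
  by move=> ij iU jU; have [t _ ->] := x_faceE ij iU jU; apply: unit_var.
have [||S p q r pq qr pS qS rS|EV EF] := @windows_generate n
  (fun U => fraction I on_tiles (x_set K U))
  (fun U i j => fraction I on_tiles (x_face K U i j)).
- move=> a b; apply: (fraction_base I0 on_tiles1).
  have [->|[z zE ->]] := x_setP (window n a b); first exact: on_tiles1.
  by apply: on_tiles_var; exists a, b.
- move=> i j ij; apply: (fraction_base I0 on_tiles1).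
  have [||t tE ->] := @x_faceE (window n i.+1 j) i j ij; rewrite ?windowP ?ltnn ?andbF //.
  by apply: on_tiles_var; rewrite /tile tE.
- have [npq _] := ltn_ord_neq pq; have [_ nrq] := ltn_ord_neq qr.
  have pqS : p \notin (q |: S)%SET by rewrite in_setU1 npq.
  have rqS : r \notin (q |: S)%SET by rewrite in_setU1 nrq.
  have hS f' : f' \in hexahedron_at K S p q r -> I f'.
    by move=> fh; apply: ideal_gen_mem; exists S, p, q, r; split.
  exact: (fraction_signed_hexahedron I0 ID IM on_tiles1 on_tilesN1 on_tilesD
    on_tilesM hS (unit_set _) (unit_face _ _ _ pq pS qS)
    (unit_face _ _ _ (ltn_trans pq qr) pqS rqS) (unit_face _ _ _ qr qS rS)).
have Ev z : fraction I on_tiles (laurent_var K z).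
  case: z => [U|t].
    by have := EV (val U); rewrite /x_set valK.
  case tE : (val t) => [U [i j]]; have := valP t; rewrite tE => /and3P[/= ij iU jU].
  by have := EF U i j ij iU jU; have [t' t'E ->] := x_faceE ij iU jU;
    rewrite -tE in t'E; rewrite (val_inj t'E).
apply: laurent_ind => [c|g h|g h|z|z].
- by apply: (fraction_base I0 on_tiles1); apply: on_tiles_const.
- exact: (fractionD ID IM on_tilesD on_tilesM).
- exact: (fractionM ID IM on_tilesM).
- exact: Ev.
- apply: (fraction_div ID IM on_tilesM (unit_var z) (Ev z) (fraction1 I0 on_tiles1)).
  by rewrite laurent_varK subrr.
Qed.

(** Write b f = c mod I with b and c in the tile variables.  Then c vanishes
    on V', so it is zero, and b is invertible modulo I. *)
Lemma vanish_ideal f : J f -> I f.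
Proof.
move=> Jf; have [b [c [Bb Bc [w Iw] Ibc]]] := fraction_laurent f.
have c0 : c = 0.
  apply: vanish_on_tiles => // v Vv; have v0 : nowhere_zero v by case: Vv.
  have := ideal_vanish Ibc Vv; rewrite evalD evalN evalM // (Jf v Vv) mulr0 add0r.
  by move/eqP; rewrite oppr_eq0 => /eqP.
have -> : f = w * (b * f - c) + (- f) * (b * w - 1) by rewrite c0; ring.
by apply: ideal_genD; apply: ideal_genM.
Qed.

End Generation.

(** * Primality, generation and the ideal of principal minors *)

Section Conclusions.
Variables (K : numFieldType) (n : nat).
Local Notation J := (vanishing_ideal (@V' K n)).

(** Cleared forms of f and g with a nonvanishing value each have a nonzero
    product, and it remains nonzero at a generic matrix. *)
Lemma vanish_prime : prime_ideal J.
Proof.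
have one_neq0 : exists M : 'M[K]_n, (1 : K) != 0 by exists 0; apply: oner_neq0.
have inJ h : (h \in [in J]) = J h :> Prop by rewrite -[RHS]in_setE.
split; [split|].
- by rewrite inJ => v _; apply: eval0.
- apply/negP; rewrite inJ => J1.
  have [M [_ M0]] := generic_matrix (@linepoly_const K 'M[K]_n 1) one_neq0.
  have /eqP := J1 (minor_vector M) (conj M0 (ex_intro _ M erefl)).
  by rewrite eval1 oner_eq0.
- move=> f g h; rewrite !inJ => Jg Jh v Vv; have v0 : nowhere_zero v by case: Vv.
  by rewrite evalD evalM // (Jg v Vv) (Jh v Vv) mulr0 add0r.
move=> f g; rewrite inJ => Jfg; apply/orP; rewrite !inJ.
have witness h : ~ J h ->
    exists2 M : 'M[K]_n, nowhere_zero (minor_vector M)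
                       & laurent_eval (minor_vector M) h != 0.
  move=> /existsNP[v /not_implyP[[v0 [M vM]] /eqP hv]].
  by exists M; rewrite -vM.
have [Jf|/witness[M M0 fM]] := pselect (J f); first by left.
have [Jg|/witness[N N0 gN]] := pselect (J g); first by right.
have [F lF FE] := linepoly_clear f (@linepoly_minor_vector K n).
have [G lG GE] := linepoly_clear g (@linepoly_minor_vector K n).
have [Q FG] : exists Q, F Q * G Q != 0.
  by apply: (@linepoly_mul_neq0 _ _ _ _ M N); rewrite ?FE ?GE.
have [P [FGP P0]] := generic_matrix (linepolyM lF lG) (ex_intro _ Q FG).
have /eqP := Jfg (minor_vector P) (conj P0 (ex_intro _ P erefl)).
by move: FGP; rewrite evalM // !mulf_eq0 FE // GE // => /negPf ->.
Qed.

Lemma vanish_generated : J = ideal_gen (@hexahedron_relations K n).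
Proof. by apply/seteqP; split=> f; [apply: vanish_ideal | apply: ideal_vanish]. Qed.

(** A matrix with nonzero principal minors need not give a point of V', as an
    odd almost-principal minor may be zero; density covers these. *)
Lemma vanish_principal :
  @L_incl K n @` vanishing_ideal (@V K n) = J `&` range (@L_incl K n).
Proof.
apply/seteqP; split=> [g [f Jf <-]|g [Jg [f _ fE]]].
  split; last by exists f.
  move=> v [v0 [M vM]]; rewrite eval_rename //; apply: Jf.
  by split=> [z|]; [apply: v0 | exists M; rewrite vM].
subst g; exists f => // v [v0 [M vM]]; subst v.
apply: (density (c := @principal_vector K n)) => // [z|N N0 _].
  exact: (linepoly_minor_vector (inl z)).
have := Jg (minor_vector N) (conj N0 (ex_intro _ N erefl)).
by rewrite eval_rename.
Qed.

End Conclusions.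

Theorem theorem4p3 (R : realType) (n : nat) (hn : (0 < n)%N) :
  [/\ prime_ideal (vanishing_ideal (@V' R[i] n)),
      vanishing_ideal (@V' R[i] n) = ideal_gen (@hexahedron_relations R[i] n)
    & @L_incl R[i] n @` vanishing_ideal (@V R[i] n)
      = vanishing_ideal (@V' R[i] n) `&` range (@L_incl R[i] n)].
Proof.
split; [exact: vanish_prime | exact: vanish_generated | exact: vanish_principal].
Qed.
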